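(* Fix $\theta\in\mathbb{R}$ and let $\mathbf{T}=(T_1,\dots,T_N)$ be $N$ i.i.d. observations from $f(\cdot|G,\theta)$ (model in the context). For any nonnegative or integrable function $g$ on the space $\mathcal{M}$ of probability measures over $\mathbb{R}$, the law $\mathcal{P}(dG|\theta,\mathbf{T})$ of $G$ given $\theta$ and $\mathbf{T}$ is characterized by $$\int_{\mathcal{M}}g(G)\,\mathcal{P}(dG|\theta,\mathbf{T})=\sum_{\mathbf{S}^+}\sum_{\mathbf{S}^-}\Bigg[\int_{\mathbb{R}^{N(\mathbf{S}^+)+N(\mathbf{S}^-)}}\left\{\int_{\mathcal{M}}g(G)\,\mathcal{P}(dG|\mathbf{V},\mathbf{U},\mathbf{S}^-,\mathbf{S}^+,\theta,\mathbf{T})\right\}\prod_{1\le j\le N-n:\,S_j^->S_{j-1}^-}H_j^-(dV_j|\mathbf{S}^-,\mathbf{Z})\prod_{1\le j\le n:\,S_j^+>S_{j-1}^+}H_j^+(dU_j|\mathbf{S}^+,\mathbf{Y})\Bigg]\pi(\mathbf{S}^-,\mathbf{S}^+|\theta,\mathbf{T}),$$ where the sums are over all $\mathbf{S}$-paths $\mathbf{S}^+$ of $n+1$ coordinates and $\mathbf{S}^-$ of $N-n+1$ coordinates.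
   Context: Species sampling model. $G$ is a random probability measure on $\mathbb{R}$ of the form $G(\cdot)=\sum_k W_k\delta_{\xi_k}(\cdot)+(1-\sum_kW_k)H(\cdot)$, where $H$ is a non-atomic probability measure on $\mathbb{R}$, the $\xi_k$ are i.i.d. $H$, and the random weights $0<W_k<1$, $\sum_kW_k\le1$, are independent of the $\xi_k$. If $X_1,\dots,X_N$ are i.i.d. from $G$ given $G$, with partition $\mathbf{p}=\{C_1,\dots,C_{N(\mathbf{p})}\}$ of $\{1,\dots,N\}$ into the classes of equal values, $C_k=\{j:X_j=X_k^*\}$, $X_k^*$ the unique values, $e_k=|C_k|$, then the joint law of $(X_1,\dots,X_N)$ is $\pi(\mathbf{p})\prod_{k=1}^{N(\mathbf{p})}H(dX_k^* )$ with $\pi(\mathbf{p})=\chi(e_1,\dots,e_{N(\mathbf{p})})$. Here $\chi$ is a symmetric function of finite lists of positive integers (the exchangeable partition probability function of $G$, defined for every sample size); $\chi$ of the empty list is $1$. Model. Given $G$ and $\theta$, the pairs $(X_k,T_k)$, $k=1,\dots,N$, are i.i.d.: $X_k\sim G$ is latent and $T_k$ given $X_k=x$ has density $x^{-1}[\mathbb{I}(0<t-\theta\le x)-\mathbb{I}(x\le t-\theta<0)]$ in $t$. So the $T_k$ are i.i.d. given $(G,\theta)$ with density $f(t|G,\theta)=\int X^{-1}[\mathbb{I}(0<t-\theta\le X)-\mathbb{I}(X\le t-\theta<0)]\,G(dX)$. $\mathbb{I}$ is the indicator. Ordering. The values $T_1-\theta,\dots,T_N-\theta$ are (almost surely) distinct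 and nonzero and are listed as $\mathbf{Z}=(Z_{N-n},\dots,Z_1)$, $Z_{N-n}<\dots<Z_1<0$, and $\mathbf{Y}=(Y_1,\dots,Y_n)$, $0<Y_1<\dots<Y_n$; so $n$ depends on $\theta$ and $\mathbf{T}$. $\mathbf{S}$-paths. An $\mathbf{S}$-path of $n+1$ coordinates is an integer vector $\mathbf{S}=(S_0,\dots,S_n)$ with $S_0=0$, $S_n=n$, $S_j\le j$ and $S_j\le S_{j+1}$ for $j=1,\dots,n-1$. A partition of $\{1,\dots,n\}$ corresponds to $\mathbf{S}$ if the maximal elements of its cells are exactly the $j$ with $S_j>S_{j-1}$ and the cell with maximal element $j$ has size $S_j-S_{j-1}$. $\mathbb{C}_{\mathbf{S}}$ is the set of partitions corresponding to $\mathbf{S}$; $|\mathbb{C}_{\mathbf{S}}|=\prod_{j:S_j>S_{j-1}}\binom{j-1-S_{j-1}}{j-S_j}$. $\mathcal{M}_{a,b}(\mathbf{S})$ is the list (multiset) $\{S_j-S_{j-1}:S_j>S_{j-1},\ a\le j\le b\}$; $\chi(\mathcal{M},\mathcal{M}')$ is $\chi$ evaluated at the concatenated list. $N(\mathbf{S})$ is the number of $j$ with $S_j>S_{j-1}$. The path distribution is $\pi(\mathbf{S}^-,\mathbf{S}^+|\theta,\mathbf{T})\propto\phi^+_\theta(\mathbf{S}^+,\mathbf{T})\,\phi^-_\theta(\mathbf{S}^-,\mathbf{S}^+,\mathbf{T})$ (normalized over all pairs of paths), with $$\phi^+_\theta(\mathbf{S}^+,\mathbf{T})=|\mathbb{C}_{\mathbf{S}^+}|\,\chi(\mathcal{M}_{1,n}(\mathbf{S}^+))\prod_{j:S_j^+>S_{j-1}^+}\int_{Y_j}^{\infty}U^{-(S_j^+-S_{j-1}^+)}H(dU),$$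 $$\phi^-_\theta(\mathbf{S}^-,\mathbf{S}^+,\mathbf{T})=|\mathbb{C}_{\mathbf{S}^-}|\,\frac{\chi(\mathcal{M}_{1,n}(\mathbf{S}^+),\mathcal{M}_{1,N-n}(\mathbf{S}^-))}{\chi(\mathcal{M}_{1,n}(\mathbf{S}^+))}\prod_{j:S_j^->S_{j-1}^-}\int_{-\infty}^{Z_j}(-V)^{-(S_j^--S_{j-1}^-)}H(dV).$$ The probability measures $H_j^\pm$ are $H_j^+(dU_j|\mathbf{S}^+,\mathbf{Y})\propto\mathbb{I}(Y_j\le U_j)U_j^{-(S_j^+-S_{j-1}^+)}H(dU_j)$ and $H_j^-(dV_j|\mathbf{S}^-,\mathbf{Z})\propto\mathbb{I}(V_j\le Z_j)(-V_j)^{-(S_j^--S_{j-1}^-)}H(dV_j)$. Write $\mathbf{U}=\{U_j:S_j^+>S_{j-1}^+\}$, $\mathbf{V}=\{V_j:S_j^->S_{j-1}^-\}$. $\mathcal{P}(dG|\mathbf{V},\mathbf{U},\mathbf{S}^-,\mathbf{S}^+,\theta,\mathbf{T})$ denotes the conditional law of $G$ given a sample $X_1,\dots,X_N$ of size $N$ from $G$ (together with $\theta,\mathbf{T}$) whose unique values are the $U_j$, with multiplicity $S_j^+-S_{j-1}^+$, and the $V_j$, with multiplicity $S_j^--S_{j-1}^-$; it equals the conditional law $\mathcal{P}(dG|\mathbf{X}^*,\mathbf{p},\theta,\mathbf{T})$ of $G$ given the corresponding unique values $\mathbf{X}^*$ and partition $\mathbf{p}$ of $(X_1,\dots,X_N)$.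 Conditional laws given $(\theta,\mathbf{T})$ are the versions given by Bayes' formula, for $\mathbf{T}$ of positive marginal density; a pair of paths for which some factor in $\phi^+_\theta\phi^-_\theta$ (including a denominator) vanishes has probability zero and contributes zero to the sum. *)

(* Defs.v *)
From HB Require Import structures.
From mathcomp Require Import all_boot all_order all_algebra.
From mathcomp Require Import all_classical all_reals all_analysis.
From mathcomp Require Import measurable_realfun.

Set Implicit Arguments.
Unset Strict Implicit.
Unset Printing Implicit Defensive.
Import Order.TTheory GRing.Theory Num.Theory.
Import numFieldNormedType.Exports.

Local Open Scope classical_set_scope.
Local Open Scope ring_scope.
Local Open Scope ereal_scope.

Section density.
Context d (T : measurableType d) (R : realType).
Variables (mu : {measure set T -> \bar R}) (f : T -> \bar R).
Hypotheses (f0 : forall x, 0 <= f x) (mf : measurable_fun [set: T] f).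

Definition mdensity (_ : forall x, 0 <= f x) (_ : measurable_fun [set: T] f)
  (A : set T) : \bar R := \int[mu]_(x in A) f x.

Let mdensity0 : mdensity f0 mf set0 = 0.
Proof. exact: integral_set0. Qed.

Let mdensity_ge0 A : 0 <= mdensity f0 mf A.
Proof. by apply: integral_ge0 => x _; exact: f0. Qed.

Let mdensity_sigma_additive : semi_sigma_additive (mdensity f0 mf).
Proof.
move=> F mF tF mUF; rewrite /mdensity ge0_integral_bigcup//; last first.
  exact: measurable_funTS.
by apply: is_cvg_ereal_nneg_natsum => n _; exact: mdensity_ge0.
Qed.

HB.instance Definition _ := isMeasure.Build _ _ _ (mdensity f0 mf)
  mdensity0 mdensity_ge0 mdensity_sigma_additive.

End density.

(* The probability measure proportional to [f(x) mu(dx)]; as in [mnormalize],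
   it is [mu] itself when the integral of [f] is [0] or [+oo]. *)
Definition tilt d (T : measurableType d) (R : realType) (mu : probability T R)
    (f : T -> \bar R) (f0 : forall x, 0 <= f x)
    (mf : measurable_fun [set: T] f) : probability T R :=
  mnormalize (mdensity mu f0 mf) mu.

Section tuple_product.
Context d (T : measurableType d) (R : realType).

Definition cons_pair n (x : T * n.-tuple T) : n.+1.-tuple T :=
  [the n.+1.-tuple T of x.1 :: x.2].

Lemma measurable_cons_pair n :
  measurable_fun [set: T * n.-tuple T] (@cons_pair n).
Proof. by apply: measurable_cons. Qed.

HB.instance Definition _ n :=
  isMeasurableFun.Build _ _ _ _ (@cons_pair n) (@measurable_cons_pair n).

Fixpoint tuple_prod (mus : seq (probability T R)) :
    probability ((size mus).-tuple T) R :=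
  match mus return probability ((size mus).-tuple T) R with
  | [::] => \d_([tuple] : 0.-tuple T)
  | mu :: mus' => distribution (mu \x tuple_prod mus') (@cons_pair (size mus'))
  end.

End tuple_product.

Section species_sampling.
Context d (Omega : measurableType d) (R : realType).
Variable P : probability Omega R.
Implicit Types (H : probability R R) (G : {RV P >-> pprobability R R}).

Definition nonatomic H := forall x : R, H [set x] = 0.

Definition sigma_family (K : set nat) (V : nat -> {RV P >-> R}) :
    set (set Omega) :=
  <<s \bigcup_(k in K) preimage_set_system setT (V k) measurable >>.

Definition iid_family (K : set nat) H (V : nat -> {RV P >-> R}) :=
  forall (J : seq nat) (A : nat -> set R), uniq J -> [set` J] `<=` K ->
    (forall k, measurable (A k)) ->
    P (\bigcap_(k in [set` J]) V k @^-1` A k) = \prod_(k <- J) H (A k).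

Definition indep_families (K : set nat) (V W : nat -> {RV P >-> R}) :=
  forall E F, sigma_family K V E -> sigma_family K W F ->
    P (E `&` F) = P E * P F.

(* The index set [K] of the atoms may be finite or infinite. *)
Definition species_sampling_model (K : set nat) (W xi : nat -> {RV P >-> R})
    H G :=
  [/\ nonatomic H, iid_family K H xi, indep_families K W xi &
    {ae P, forall w,
      [/\ forall k, K k -> (0 < W k w < 1)%R,
          \esum_(k in K) (W k w)%:E <= 1 &
          forall B : set R, measurable B ->
            (G w : probability R R) B =
              \esum_(k in K) ((W k w)%:E * \d_(xi k w) B) +
              (1 - \esum_(k in K) (W k w)%:E) * H B]}].

Definition cell_sizes (I : finType) (p : {set {set I}}) : seq nat :=
  [seq #|C : {set I}| | C <- enum p].

(* The last clause is the joint law of a sample [X_1, ..., X_M] from [G] (for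
   every [M]), evaluated on the measurable rectangles [A_1 * ... * A_M]: given
   the partition [p], all [X_i] with [i] in the cell [C] equal one draw from
   [H]. *)
Definition is_eppf H G (chi : seq nat -> R) :=
  [/\ chi [::] = 1%R,
      forall s, all (leq 1) s -> (0 <= chi s)%R,
      forall s s', all (leq 1) s -> perm_eq s s' -> chi s = chi s' &
      forall M (A : 'I_M -> set R), (forall i, measurable (A i)) ->
        \int[P]_w \prod_(i < M) (G w : probability R R) (A i) =
        \sum_(p : {set {set 'I_M}} | finset.partition p [set: 'I_M]%SET)
          (chi (cell_sizes p))%:E *
          \prod_(C in p) H (\bigcap_(i in [set` C]) A i)].

End species_sampling.

Lemma measurable_invr (R : realType) :
  measurable_fun [set: R] (fun x : R => x^-1)%R.
Proof.
rewrite [X in measurable_fun _ X](_ : _ = fun x => x * (x ^+ 2) `^ (-1))%R.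
  apply: measurable_funM => //.
  apply: (@measurableT_comp _ _ _ _ _ _ (@powR R ^~ (-1)%R)).
    exact: measurable_powR.
  exact: measurable_funX.
apply/funext => x; rewrite powR_inv1 ?sqr_ge0//.
have [->|x0] := eqVneq x 0%R; first by rewrite invr0 mul0r.
by rewrite expr2 invfM mulrA divff// mul1r.
Qed.

Lemma emeasurable_prod d (T : measurableType d) (R : realType) (I : Type)
    (r : seq I) (f : I -> T -> \bar R) :
  (forall i, measurable_fun [set: T] (f i)) ->
  measurable_fun [set: T] (fun x => \prod_(i <- r) f i x).
Proof.
move=> mf; elim: r => [|i r IH].
  by under eq_fun do rewrite big_nil; exact: measurable_cst.
by under eq_fun do rewrite big_cons; exact: emeasurable_funM.
Qed.

Section model.
Variable R : realType.
Implicit Types (theta x s : R) (Gam : pprobability R R).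

Definition kern theta x s : R :=
  (x^-1 * ((0 < s - theta <= x)%R%:R - (x <= s - theta < 0)%R%:R))%R.

Definition mix_density theta Gam s : \bar R :=
  \int[(Gam : probability R R)]_x (kern theta x s)%:E.

Definition likelihood theta N (t : N.-tuple R) Gam : \bar R :=
  \prod_(i < N) mix_density theta Gam (tnth t i).

Definition complete_likelihood theta N (t : N.-tuple R) (x : N.-tuple R) :
    \bar R :=
  (\prod_(i < N) kern theta (tnth x i) (tnth t i))%:E.

Lemma kern_ge0 theta x s : (0 <= kern theta x s)%R.
Proof.
rewrite /kern; have [x0|x0] := ltrP 0%R x.
  rewrite mulr_ge0 ?invr_ge0 ?(ltW x0)// subr_ge0 ler_nat.
  have -> // : (x <= s - theta < 0)%R = false.
  by apply/negP => /andP[xs s0]; have := lt_le_trans x0 (le_trans xs (ltW s0));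
    rewrite ltxx.
rewrite mulr_le0 ?invr_le0// subr_le0 ler_nat.
have -> // : (0 < s - theta <= x)%R = false.
by apply/negP => /andP[s0 sx]; have := lt_le_trans s0 (le_trans sx x0);
  rewrite ltxx.
Qed.

Lemma measurable_kern theta s : measurable_fun [set: R] (kern theta ^~ s).
Proof.
have mb (b : R -> bool) : measurable_fun [set: R] b ->
    measurable_fun [set: R] (fun x => (b x)%:R : R).
  move=> mb; rewrite [X in measurable_fun _ X](_ : _ =
      (fun x => if b x then 1 else 0 : R)%R).
    exact: measurable_fun_ifT.
  by apply/funext => x; case: (b x).
apply: measurable_funM; first exact: measurable_invr.
apply: measurable_funB; apply: mb; apply: measurable_and;
  by [exact: measurable_cst|exact: measurable_fun_ler].
Qed.

Lemma likelihood_ge0 theta N (t : N.-tuple R) Gam : 0 <= likelihood theta t Gam.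
Proof.
apply: prode_ge0 => i _; apply: integral_ge0 => x _.
by rewrite lee_fin kern_ge0.
Qed.

Lemma measurable_likelihood theta N (t : N.-tuple R) :
  measurable_fun [set: pprobability R R] (likelihood theta t).
Proof.
apply: emeasurable_prod => i.
apply: (measurable_fun_integral_kernel
  (l := fun Gam : pprobability R R => (Gam : probability R R))).
- move=> U mU; exact: (measurable_kernel
    (kprobability (@measurable_id _ (pprobability R R) setT)) U mU).
- by move=> x; rewrite lee_fin kern_ge0.
- by apply/measurable_EFinP; exact: measurable_kern.
Qed.

Lemma complete_likelihood_ge0 theta N (t x : N.-tuple R) :
  0 <= complete_likelihood theta t x.
Proof.
by rewrite lee_fin prodr_ge0// => i _; exact: kern_ge0.
Qed.

Lemma measurable_complete_likelihood theta N (t : N.-tuple R) :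
  measurable_fun [set: N.-tuple R] (complete_likelihood theta t).
Proof.
apply/measurable_EFinP; apply: measurable_prod => i _.
apply: (@measurableT_comp _ _ _ _ _ _ (kern theta ^~ (tnth t i))).
  exact: measurable_kern.
exact: measurable_tnth.
Qed.

End model.

Section posterior.
Context d (Omega : measurableType d) (R : realType).
Variables (P : probability Omega R) (G : {RV P >-> pprobability R R}).
Variables (theta : R) (N : nat).
Implicit Types (X T : 'I_N -> {RV P >-> R}) (t : N.-tuple R).

(* Given [G], the pairs [(X i, T i)] are i.i.d., [X i] has law [G] and [T i]
   has density [kern theta x] given [X i = x]. *)
Definition mixture_model X T :=
  forall (B : set (pprobability R R)) (A C : 'I_N -> set R),
    measurable B -> (forall i, measurable (A i)) ->
    (forall i, measurable (C i)) ->
    P [set w | [/\ B (G w), forall i, A i (X i w) & forall i, C i (T i w)]] =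
    \int[P]_(w in G @^-1` B) \prod_(i < N)
      \int[(G w : probability R R)]_(x in A i)
        \int[lebesgue_measure]_(s in C i) (kern theta x s)%:E.

Definition marginal_density t : \bar R :=
  \int[distribution P G]_Gam likelihood theta t Gam.

(* The law of [G] given [theta] and the data [t], by Bayes' formula. *)
Definition posterior t : probability (pprobability R R) R :=
  tilt (distribution P G) (likelihood_ge0 theta t)
    (measurable_likelihood theta t).

Definition sample_tuple X (w : Omega) : N.-tuple R := [tuple X i w | i < N].

Lemma measurable_sample_tuple X : measurable_fun [set: Omega] (sample_tuple X).
Proof.
apply/measurable_fun_tnthP => i.
apply: (eq_measurable_fun (X i)) => [w _|]; last exact: measurable_funPT.
by rewrite /= tnth_mktuple.
Qed.

Definition complete_posterior X t : probability Omega R :=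
  tilt P (fun w => complete_likelihood_ge0 theta t (sample_tuple X w))
    (measurableT_comp (measurable_complete_likelihood theta t)
       (measurable_sample_tuple X)).

(* [Q] is a version of the conditional law of [G] given the sample [X] (and
   [theta], [t]), under the joint law of [(G, X)] given [theta] and [t]. *)
Definition cond_law_given_sample X t
    (Q : R.-pker (N.-tuple R) ~> (pprobability R R)) :=
  forall (A : set (N.-tuple R)) (B : set (pprobability R R)),
    measurable A -> measurable B ->
    complete_posterior X t (sample_tuple X @^-1` A `&` G @^-1` B) =
    \int[complete_posterior X t]_(w in sample_tuple X @^-1` A)
      Q (sample_tuple X w) B.

End posterior.

(* A path [S_0, ..., S_n] is a finite function on ['I_n.+1].  The ordinal
   [i : 'I_n] stands for the index [i + 1] of [1, ..., n], both as a path
   coordinate and as a point of the set that is partitioned. *)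
Section spaths.
Variable n : nat.
Implicit Types (S : {ffun 'I_n.+1 -> 'I_n.+1}) (p : {set {set 'I_n}}).

Definition is_spath S : bool :=
  [&& S ord0 == ord0, S ord_max == ord_max,
      [forall j, (S j <= j)%N] &
      [forall i : 'I_n, (S (widen_ord (leqnSn n) i) <= S (lift ord0 i))%N]].

Definition incr S (i : 'I_n) : nat :=
  (S (lift ord0 i) - S (widen_ord (leqnSn n) i))%N.

Definition jump S (i : 'I_n) : bool :=
  (S (widen_ord (leqnSn n) i) < S (lift ord0 i))%N.

Definition jumps S : seq 'I_n := [seq i <- enum 'I_n | jump S i].

Definition jump_sizes S : seq nat := [seq incr S i | i <- jumps S].

Definition is_top (C : {set 'I_n}) (i : 'I_n) : bool :=
  (i \in C) && [forall k in C, (k <= i)%N].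

Definition corresponds S p : bool :=
  [&& finset.partition p [set: 'I_n]%SET,
      [forall i, jump S i == [exists C in p, is_top C i]] &
      [forall C in p, forall i, is_top C i ==> (#|C| == incr S i)]].

Definition path_partitions S : {set {set {set 'I_n}}} :=
  [set p | corresponds S p]%SET.

Definition top_of_cell p (i : 'I_n) : 'I_n :=
  [arg max_(k > i in finset.pblock p i) (k : nat)].

(* The value at the jump [i] of a vector indexed by the jumps of [S]. *)
Definition at_jump (R : realType) S (u : seq R) (i : 'I_n) : R :=
  nth 0%R u (index i (jumps S)).

End spaths.

Section inv_power.
Variable R : realType.

(* [`|x| ^- e] is [x ^- e] on [`[Y_j, +oo[] and [(- x) ^- e] on [`]-oo, Z_j]],
   the two intervals that are used. *)
Definition inv_power (D : interval R) (e : nat) (x : R) : \bar R :=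
  (\1_[set` D] x * `|x| ^- e)%:E.

Lemma inv_power_ge0 D e x : 0 <= inv_power D e x.
Proof. by rewrite lee_fin mulr_ge0// invr_ge0 exprn_ge0. Qed.

Lemma measurable_inv_power D e : measurable_fun [set: R] (inv_power D e).
Proof.
apply/measurable_EFinP/measurable_funM; first exact: measurable_indic.
apply: (@measurableT_comp _ _ _ _ _ _ (fun y : R => y^-1)%R).
  exact: measurable_invr.
by apply/measurable_funX; exact: normr_measurable.
Qed.

End inv_power.

Section path_distribution.
Variables (R : realType) (H : probability R R) (chi : seq nat -> R).
Variables (theta : R) (N : nat) (t : N.-tuple R).

(* Increasing [Ys] and decreasing [Zs]: [Ys`_i] is [Y_(i+1)] and [Zs`_i] is
   [Z_(i+1)].  If the data differ from [theta], then [size Zs] is [N - n]. *)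
Definition Ys : seq R :=
  sort <=%R [seq (s - theta)%R | s <- t & (0 < s - theta)%R].

Definition Zs : seq R :=
  sort >=%R [seq (s - theta)%R | s <- t & (s - theta < 0)%R].

Local Notation n := (size Ys).
Local Notation m := (size Zs).

Definition pos_path := {ffun 'I_n.+1 -> 'I_n.+1}.
Definition neg_path := {ffun 'I_m.+1 -> 'I_m.+1}.

Implicit Types (Sp : pos_path) (Sm : neg_path).

Definition phi_pos Sp : R :=
  (#|path_partitions Sp|%:R * chi (jump_sizes Sp) *
   \prod_(i <- jumps Sp)
     \int[H]_(u in `[(Ys`_i)%R, +oo[) (u ^- incr Sp i))%R.

Definition phi_neg Sm Sp : R :=
  (#|path_partitions Sm|%:R *
   (chi (jump_sizes Sp ++ jump_sizes Sm) / chi (jump_sizes Sp)) *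
   \prod_(i <- jumps Sm)
     \int[H]_(v in `]-oo, (Zs`_i)%R]) ((- v) ^- incr Sm i))%R.

Definition path_prob Sm Sp : R :=
  (phi_pos Sp * phi_neg Sm Sp /
   \sum_(Sp' : pos_path | is_spath Sp') \sum_(Sm' : neg_path | is_spath Sm')
     phi_pos Sp' * phi_neg Sm' Sp')%R.

Definition H_pos Sp (i : 'I_n) : probability R R :=
  tilt H (inv_power_ge0 `[(Ys`_i)%R, +oo[ (incr Sp i))
    (measurable_inv_power `[(Ys`_i)%R, +oo[ (incr Sp i)).

Definition H_neg Sm (i : 'I_m) : probability R R :=
  tilt H (inv_power_ge0 `]-oo, (Zs`_i)%R] (incr Sm i))
    (measurable_inv_power `]-oo, (Zs`_i)%R] (incr Sm i)).

Definition U_law Sp := tuple_prod [seq H_pos Sp i | i <- jumps Sp].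

Definition V_law Sm := tuple_prod [seq H_neg Sm i | i <- jumps Sm].

(* The sample with unique values [v], [u] and with the partitions [pm] of the
   negative and [pp] of the positive observations.  An observation [s] with
   [s - theta = Y_j] gets the value [u] of the top of the cell of [j] in [pp],
   and likewise for [Z_j], [v] and [pm]. *)
Definition sample_of Sm Sp (pm : {set {set 'I_m}}) (pp : {set {set 'I_n}})
    (v u : seq R) : N.-tuple R :=
  [tuple of [seq
     let y := (s - theta)%R in
     if insub (index y Ys) is Some i then at_jump Sp u (top_of_cell pp i)
     else if insub (index y Zs) is Some i then
       at_jump Sm v (top_of_cell pm i)
     else 0%R
   | s <- t]].

End path_distribution.

(* Main.v *)
From HB Require Import structures.
Require Import Defs.
From mathcomp Require Import all_boot all_order all_algebra fingroup perm.
From mathcomp Require Import all_classical all_reals all_analysis.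
From mathcomp Require Import measurable_realfun ring lra.

(** Fix [theta] and the data [t].  Every statement about the posterior law is
    first proved on a measurable set [B] of random measures, where it is an
    identity between integrals over the latent sample [X]; integrals of a
    function [g] of the random measure come last.

    The argument has four ingredients.

    - Bayes' formula.  The data enter through the likelihood of the complete
      sample, [complete_likelihood]; averaging it over [X] given [G] gives back
      the likelihood of [G] ([integral_kernels]).  Hence the posterior mass of
      [B], times the normalizing constant, is the integral of the complete
      likelihood over the event that [G] lies in [B].

    - Ties.  The complete likelihood vanishes unless latent values of positive
      observations are positive and those of negative observations negative, so
      ties occur within each of the two groups only, and the event is split
      according to the pair of tie partitions ([complete_likelihood_split]).
      On one such event the likelihood depends, for each cell, on the value, on
      the size and on the largest member of the cell only
      ([prod_inv_power_cell_top]): that member is the most constraining one.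
      Size and largest member of every cell are what an S-path records, and a
      partition has exactly one S-path ([sum_partition_path]).

    - Exchangeability.  Two pairs of partitions with the same paths differ by a
      permutation of the observations, so they contribute equally
      ([tie_likelihood_exchange]), and one representative, counted with its
      multiplicity, is enough.

    - The law of a sample with prescribed ties.  As [H] has no atoms, a sample
      has tie partition [p] with probability [chi] of the cell sizes, and then
      its distinct values are i.i.d. from [H] ([sample_law_ker]).  Weighting
      them by the likelihood tilts each value separately, which gives the laws
      of [V] and [U] and the factors of [phi_pos] and [phi_neg]
      ([ge0_integral_path_term], [phi_path_weight]).

    Given the sample, the law of [G] is the kernel [Q]; the same identity with
    [B] the whole space computes the normalizing constant, and
    [posterior_paths] follows by division. *)

Set Implicit Arguments.
Unset Strict Implicit.
Unset Printing Implicit Defensive.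
Import Order.TTheory GRing.Theory Num.Theory.
Import numFieldNormedType.Exports.

Local Open Scope classical_set_scope.
Local Open Scope ring_scope.
Local Open Scope ereal_scope.

(** * Mixtures of measures *)

(** A factor [+oo] is allowed: the limit is then [0] or [+oo] according to
    whether [u] is identically null. *)
Lemma ge0_nd_cvgeZl (R : realType) (x : \bar R) (u : (\bar R)^nat) (l : \bar R) :
  0 <= x -> (forall n, 0 <= u n) -> nondecreasing_seq u ->
  u @ \oo --> l -> (fun n => x * u n) @ \oo --> x * l.
Proof.
move=> x0 u0 ndu ul.
have ule n : u n <= l.
  rewrite -(cvg_lim (@ereal_hausdorff R) ul).
  rewrite (cvg_lim _ (ereal_nondecreasing_cvgn ndu))//.
  by apply: ereal_sup_ubound; exists n.
have [xfin|] := boolP (x \is a fin_num); first exact: cvgeZl.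
rewrite ge0_fin_numE// -leNgt leye_eq => /eqP ->.
have [/eqP l0|l0] := boolP (l == 0).
  rewrite l0 mule0 [X in X @ _](_ : _ = cst 0); first exact: cvg_cst.
  apply/funext => n /=; rewrite [X in _ * X](_ : _ = 0) ?mule0//.
  by apply/eqP; rewrite eq_le u0 andbT -l0.
have lpos : 0 < l by rewrite lt0e l0 (le_trans (u0 0%N)).
rewrite gt0_mulye//; apply: cvg_near_cst.
have : \forall n \near \oo, 0 < u n.
  exact: (ul [set z | 0 < z] (open_ereal_gt' lpos)).
by apply: filterS => n un; rewrite gt0_mulye.
Qed.

(** Two ways of averaging a family of measures are compared by comparing the
    averages of sets; [ge0_integral_mixture] then transfers the equality to
    integrals of nonnegative functions. *)
Section mixture.
Context d d' (X : measurableType d) (Y : measurableType d') (R : realType).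
Variables (mu : {measure set X -> \bar R}) (rho : X -> \bar R)
  (k : X -> {measure set Y -> \bar R}).

Definition mixture of (forall x, 0 <= rho x) & measurable_fun [set: X] rho &
    (forall B, measurable B -> measurable_fun [set: X] (k ^~ B)) :=
  fun B : set Y => \int[mu]_x (rho x * k x B).

Hypotheses (rho0 : forall x, 0 <= rho x) (mrho : measurable_fun [set: X] rho)
  (mk : forall B, measurable B -> measurable_fun [set: X] (k ^~ B)).

Local Notation nu := (mixture rho0 mrho mk).

Let mixture0 : nu set0 = 0.
Proof. by apply: integral0_eq => x _; rewrite measure0 mule0. Qed.

Let mixture_ge0 B : 0 <= nu B.
Proof. by apply: integral_ge0 => x _; rewrite mule_ge0. Qed.

Let mixture_sigma_additive : semi_sigma_additive nu.
Proof.
move=> F mF tF mUF.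
have -> : nu (\bigcup_n F n) = \sum_(n <oo) nu (F n).
  rewrite /mixture -integral_nneseries//; last 2 first.
  - by move=> n; apply: emeasurable_funM => //; exact: mk.
  - by move=> n x _; rewrite mule_ge0.
  apply: eq_integral => x _.
  apply/esym/cvg_lim => //.
  rewrite [X in X @ _](_ : _ = fun n => rho x * \sum_(0 <= i < n) k x (F i)).
    apply: ge0_nd_cvgeZl => //.
    - by move=> n; exact: sume_ge0.
    - by move=> m n mn; exact: lee_sum_nneg_natr.
    - exact: measure_semi_sigma_additive.
  by apply/funext => n; rewrite ge0_sume_distrr.
by apply: is_cvg_ereal_nneg_natsum => n _; exact: mixture_ge0.
Qed.

HB.instance Definition _ := isMeasure.Build _ _ _ nu
  mixture0 mixture_ge0 mixture_sigma_additive.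

Import HBNNSimple.

Lemma ge0_integral_mixture (f : Y -> \bar R) :
  (forall y, 0 <= f y) -> measurable_fun [set: Y] f ->
  \int[nu]_y f y = \int[mu]_x (rho x * \int[k x]_y f y).
Proof.
move=> f0 mf; pose f_ := nnsfun_approx measurableT mf.
have cvgf y : (f_ n y)%:E @[n --> \oo] --> f y by apply: cvg_nnsfun_approx.
have mint g : (forall y, 0 <= g y) -> measurable_fun [set: Y] g ->
    measurable_fun [set: X] (fun x => rho x * \int[k x]_y g y).
  by move=> g0 mg; apply: emeasurable_funM => //;
    exact: measurable_fun_integral_kernel.
have mf_ n : measurable_fun [set: Y] (fun y => (f_ n y)%:E).
  exact/measurable_EFinP.
have f_0 n y : 0 <= (f_ n y)%:E by rewrite lee_fin.
have ndf y : {homo (fun n => (f_ n y)%:E) : m n / (m <= n)%N >-> m <= n}.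
  by move=> m n mn; rewrite lee_fin; exact/lefP/nd_nnsfun_approx.
have cvgk x : \int[k x]_y (f_ n y)%:E @[n --> \oo] --> \int[k x]_y f y.
  have -> : \int[k x]_y f y = \int[k x]_y limn (fun n => (f_ n y)%:E).
    by apply: eq_integral => y _; apply/esym/cvg_lim.
  by apply: cvg_monotone_convergence => // y _; exact: ndf.
transitivity (limn (fun n => \int[nu]_y (f_ n y)%:E)).
  rewrite -monotone_convergence//.
  by apply: eq_integral => y _; apply/esym/cvg_lim.
transitivity (limn (fun n => \int[mu]_x (rho x * \int[k x]_y (f_ n y)%:E))).
  congr (limn _); apply/funext => n.
  rewrite integralT_nnsfun sintegralE.
  transitivity (\sum_(r \in range (f_ n))
      \int[mu]_x (rho x * (r%:E * k x (f_ n @^-1` [set r])))).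
    apply: eq_fsbigr => r; rewrite inE => -[y _ <-].
    have mr : measurable (f_ n @^-1` [set f_ n y]) by exact: measurable_sfunP.
    rewrite -ge0_integralZl//.
    - by apply: eq_integral => x _; rewrite muleCA.
    - by apply: emeasurable_funM => //; exact: mk.
    - by move=> x _; rewrite mule_ge0.
  rewrite -ge0_integral_fsum//; last 2 first.
  - move=> r; apply: emeasurable_funM => //; apply: measurable_funeM.
    by apply: mk; exact: measurable_sfunP.
  - by move=> r x _; rewrite mule_ge0//; exact: nnsfun_mulemu_ge0.
  apply: eq_integral => x _; rewrite integralT_nnsfun sintegralE.
  rewrite ge0_mule_fsumr// => r; exact: nnsfun_mulemu_ge0.
rewrite -monotone_convergence//; last 3 first.
- by move=> n; exact: mint.
- by move=> n x _; rewrite mule_ge0// integral_ge0.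
- move=> x _ m n mn; apply: lee_wpmul2l => //; apply: ge0_le_integral => // y _.
  exact: ndf.
apply: eq_integral => x _; apply/cvg_lim => //.
apply: ge0_nd_cvgeZl => //.
- by move=> n; exact: integral_ge0.
- by move=> m n mn; apply: ge0_le_integral => // y _; exact: ndf.
Qed.

End mixture.

(** A measure with density is the mixture of the Dirac masses. *)
Lemma ge0_integral_mdensity d (X : measurableType d) (R : realType)
    (mu : {measure set X -> \bar R}) (f : X -> \bar R)
    (f0 : forall x, 0 <= f x) (mf : measurable_fun [set: X] f)
    (g : X -> \bar R) :
  (forall x, 0 <= g x) -> measurable_fun [set: X] g ->
  \int[mdensity mu f0 mf]_x g x = \int[mu]_x (f x * g x).
Proof.
move=> g0 mg.
have md (B : set X) : measurable B ->
    measurable_fun [set: X] (fun x => \d_x B : \bar R).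
  by move=> mB; apply/measurable_EFinP; exact: measurable_indic.
rewrite [LHS](eq_measure_integral (mixture mu f0 mf md)); last first.
  move=> A mA _ /=; rewrite /mixture /mdensity [LHS]integral_mkcond.
  apply: eq_integral => x _; rewrite patchE /= /dirac indicE.
  by case: ifPn => _ /=; rewrite ?mule1 ?mule0.
rewrite ge0_integral_mixture//; apply: eq_integral => x _.
by rewrite integral_dirac// diracT mul1e.
Qed.

(** This holds even for the null measure, where both sides vanish. *)
Lemma mnormalizeK d (X : measurableType d) (R : realType)
    (nu : {measure set X -> \bar R}) (mu : probability X R) (A : set X) :
  nu [set: X] < +oo -> measurable A ->
  nu [set: X] * mnormalize nu mu A = nu A.
Proof.
move=> nuoo mA; rewrite /mnormalize (lt_eqF nuoo) orbF.
case: ifPn => [/eqP nu0|nu0].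
  rewrite nu0 mul0e; apply/eqP; rewrite eq_sym -measure_le0 -nu0.
  by apply: le_measure => //; rewrite inE.
have nufin : nu [set: X] \is a fin_num by rewrite ge0_fin_numE.
rewrite muleCA -{1}(fineK nufin) -EFinM divff ?mule1//.
by rewrite fine_eq0.
Qed.

Lemma tiltE d (X : measurableType d) (R : realType) (mu : probability X R)
    (f : X -> \bar R) (f0 : forall x, 0 <= f x)
    (mf : measurable_fun [set: X] f) (A : set X) :
  \int[mu]_x f x < +oo -> measurable A ->
  \int[mu]_x f x * tilt mu f0 mf A = \int[mu]_(x in A) f x.
Proof. exact: (@mnormalizeK _ _ _ (mdensity mu f0 mf)). Qed.

Lemma ge0_integral_tilt d (X : measurableType d) (R : realType)
    (mu : probability X R) (f : X -> \bar R) (f0 : forall x, 0 <= f x)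
    (mf : measurable_fun [set: X] f) (g : X -> \bar R) :
  \int[mu]_x f x < +oo ->
  (forall x, 0 <= g x) -> measurable_fun [set: X] g ->
  \int[mu]_x f x * \int[tilt mu f0 mf]_x g x = \int[mu]_x (f x * g x).
Proof.
move=> foo g0 mg; rewrite -ge0_integral_mdensity//.
have fge0 : (0 <= fine (\int[mu]_x f x))%R by rewrite fine_ge0// integral_ge0.
rewrite [RHS](eq_measure_integral (mscale (NngNum fge0) (tilt mu f0 mf))).
  by rewrite ge0_integral_mscale//= fineK// ge0_fin_numE// integral_ge0.
move=> A mA _.
transitivity ((fine (\int[mu]_x f x))%:E * tilt mu f0 mf A); last by [].
by rewrite fineK ?tiltE// ge0_fin_numE// integral_ge0.
Qed.

(** * Measures on tuples *)
Lemma measurable_rectangle d (T : measurableType d) n (A : 'I_n -> set T) :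
  (forall i, measurable (A i)) ->
  measurable [set x : n.-tuple T | forall i, A i (tnth x i)].
Proof.
move=> mA.
rewrite [X in measurable X](_ : _ =
    \bigcap_(i in [set: 'I_n]) (@tnth _ T ^~ i @^-1` A i)).
  apply: fin_bigcap_measurable => // i _.
  by rewrite -[X in measurable X]setTI; exact: measurable_tnth.
by apply/seteqP; split => [x xA i _|x xA i]; exact: xA.
Qed.

(** The rectangles are closed under intersection and generate. *)
Lemma tuple_measure_unique d (T : measurableType d) (R : realType) n
    (m1 m2 : {measure set (n.-tuple T) -> \bar R}) :
  m1 [set: n.-tuple T] < +oo ->
  (forall A : 'I_n -> set T, (forall i, measurable (A i)) ->
    m1 [set x | forall i, A i (tnth x i)] =
    m2 [set x | forall i, A i (tnth x i)]) ->
  forall B, measurable B -> m1 B = m2 B.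
Proof.
move=> m1oo m12 B mB.
pose G : set (set (n.-tuple T)) :=
  [set S | exists2 A : 'I_n -> set T, forall i, measurable (A i) &
             S = [set x | forall i, A i (tnth x i)] ].
have GT : G setT by exists (fun=> setT) => //; apply/seteqP; split.
apply: (g_sigma_algebra_measure_unique G _ (fun=> setT)) => //.
- by move=> _ [A mA ->]; exact: measurable_rectangle.
- by rewrite bigcup_const//; exists 0%N.
- move=> _ _ [A mA ->] [C mC ->]; exists (fun i => A i `&` C i).
    by move=> i; exact: measurableI.
  apply/seteqP; split => [x [xA xC] i|x xAC]; first by split.
  by split => i; have [] := xAC i.
- by move=> _ [A mA ->]; exact: m12.
move: B mB; apply: smallest_sub; first exact: smallest_sigma_algebra.
case: n => [|n] in m1 m2 m1oo m12 G GT *; first by rewrite big_ord0.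
rewrite -bigcup_mkord_ord; apply: bigcup_sub => i _ _ [C mC <-].
apply: sub_sigma_algebra.
exists (fun j => if j == inord i then C else setT).
  by move=> j; case: ifP.
rewrite setTI; apply/seteqP; split => x /= xC; last first.
  by have := xC (inord i); rewrite eqxx.
by move=> j; case: eqP => // ->.
Qed.

(** Fubini's theorem, one coordinate at a time. *)
Lemma ge0_integral_tuple_prod d (T : measurableType d) (R : realType)
    (mu0 : probability T R) (mus : seq (probability T R))
    (f : nat -> T -> \bar R) :
  (forall k x, 0 <= f k x) -> (forall k, measurable_fun [set: T] (f k)) ->
  \int[tuple_prod mus]_u \prod_(k < size mus) f k (tnth u k) =
  \prod_(k < size mus) \int[nth mu0 mus k]_x f k x.
Proof.
elim: mus f => [|mu mus IH] f f0 mf.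
  rewrite big_ord0 [tuple_prod _]/=; under eq_integral do rewrite big_ord0.
  by rewrite integral_cst// mul1e; exact: diracT.
have mprod n (h : nat -> T -> \bar R) : (forall k, measurable_fun setT (h k)) ->
    measurable_fun [set: n.-tuple T]
      (fun u : n.-tuple T => \prod_(k < n) h k (tnth u k)).
  move=> mh; apply: emeasurable_prod => i.
  by apply: (measurableT_comp (mh i)); exact: measurable_tnth.
rewrite [LHS]ge0_integral_distribution//; last 2 first.
- exact: mprod.
- by move=> u; exact: prode_ge0.
rewrite (fubini_tonelli1 (_ \o _)); last 2 first.
- by apply: measurableT_comp; [exact: mprod|exact: measurable_cons_pair].
- by move=> x; exact: prode_ge0.
rewrite /fubini_F big_ord_recl /= -(IH (fun k => f k.+1))//.
rewrite -ge0_integralZr//; last first.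
- by apply: integral_ge0 => u _; exact: prode_ge0.
apply: eq_integral => x _; rewrite -ge0_integralZl//.
- apply: eq_integral => u _; rewrite big_ord_recl; congr (_ * _).
  by apply: eq_bigr => i _; rewrite tnthS.
- exact: mprod (fun k => f k.+1) _.
- by move=> u _; exact: prode_ge0.
Qed.

(** * Conditionally independent samples *)
Lemma emeasurable_prod_cond d (T : measurableType d) (R : realType) (I : Type)
    (r : seq I) (Q : pred I) (f : I -> T -> \bar R) :
  (forall i, measurable_fun [set: T] (f i)) ->
  measurable_fun [set: T] (fun x => \prod_(i <- r | Q i) f i x).
Proof.
move=> mf; under eq_fun do rewrite big_mkcond.
by apply: emeasurable_prod => i; case: (Q i).
Qed.

Lemma integral_indicM d (T : measurableType d) (R : realType)
    (mu : {measure set T -> \bar R}) (D : set T) (f : T -> \bar R) :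
  \int[mu]_(x in D) f x = \int[mu]_x ((\1_D x)%:E * f x).
Proof.
rewrite integral_mkcond; apply: eq_integral => x _; rewrite patchE indicE.
by case: ifPn => _ /=; rewrite ?mul1e ?mul0e.
Qed.

Lemma prod_indic (R : realType) (T : Type) (J : finType) (A : J -> set T)
    (x : J -> T) :
  \prod_(i : J) (\1_(A i) (x i))%:E =
  ((`[< forall i, A i (x i) >])%:R)%:E :> \bar R.
Proof.
case: asboolP => [xA|/existsNP[i xA]].
  by rewrite big1// => i _; rewrite indicE mem_set.
by rewrite (bigD1 i)//= indicE memNset// mul0e.
Qed.

Section conditionally_iid.
Context d (Omega : measurableType d) (R : realType).
Variables (P : probability Omega R) (G : {RV P >-> pprobability R R}).

Lemma measurable_random_measure (B : set R) : measurable B ->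
  measurable_fun [set: Omega] (fun w => (G w : probability R R) B).
Proof.
exact: (measurable_kernel (kprobability (@measurable_funPT _ _ _ _ G))).
Qed.

Lemma measurable_random_integral (f : R -> \bar R) : (forall x, 0 <= f x) ->
  measurable_fun [set: R] f ->
  measurable_fun [set: Omega] (fun w => \int[(G w : probability R R)]_x f x).
Proof.
by move=> f0 mf; apply: measurable_fun_integral_kernel => // U;
  exact: measurable_random_measure.
Qed.

(** The hypothesis is the conclusion for indicators.  They are replaced by
    arbitrary functions one coordinate at a time: with the other coordinates
    fixed, both sides are integrals of [f i] against mixtures of measures that
    agree on all Borel sets. *)
Lemma conditionally_iid_integral (N : nat) (X : 'I_N -> {RV P >-> R})
    (D : set Omega) :
  measurable D ->
  (forall A : 'I_N -> set R, (forall i, measurable (A i)) ->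
    P [set w | D w /\ forall i, A i (X i w)] =
    \int[P]_(w in D) \prod_(i < N) (G w : probability R R) (A i)) ->
  forall f : 'I_N -> R -> \bar R, (forall i x, 0 <= f i x) ->
  (forall i, measurable_fun [set: R] (f i)) ->
  \int[P]_(w in D) \prod_(i < N) f i (X i w) =
  \int[P]_(w in D) \prod_(i < N) \int[(G w : probability R R)]_x f i x.
Proof.
move=> mD DX.
(* The first [k] functions are arbitrary, the others are indicators. *)
suff H k : (k <= N)%N -> forall f : 'I_N -> R -> \bar R,
    (forall i x, 0 <= f i x) -> (forall i, measurable_fun [set: R] (f i)) ->
    (forall i : 'I_N, (k <= i)%N ->
      exists2 A : set R, measurable A & f i = fun x => (\1_A x)%:E) ->
    \int[P]_w ((\1_D w)%:E * \prod_(i < N) f i (X i w)) =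
    \int[P]_w ((\1_D w)%:E *
       \prod_(i < N) \int[(G w : probability R R)]_x f i x).
  move=> f f0 mf; rewrite [LHS]integral_indicM [RHS]integral_indicM.
  apply: (H N) => // i.
  by rewrite leqNgt ltn_ord.
elim: k => [_|k IH kN] f f0 mf fA.
  have {fA}/choice[A fA] i : exists A : set R,
      measurable A /\ f i = fun x => (\1_A x)%:E.
    by have [A mA ->] := fA i isT; exists A.
  have -> : \int[P]_w ((\1_D w)%:E * \prod_(i < N) f i (X i w)) =
      P [set w | D w /\ forall i, A i (X i w)].
    set E := [set w | _]; rewrite -(setIT E) -integral_indic//; last first.
      rewrite [X in measurable X](_ : _ =
          D `&` \bigcap_(i in [set: 'I_N]) (X i @^-1` A i)).
        apply: measurableI => //; apply: fin_bigcap_measurable => // i _.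
        rewrite -[Y in measurable Y]setTI; apply: measurable_funPT => //.
        exact: (fA i).1.
      by apply/seteqP; split => [w [Dw wA]|w [Dw wA]]; split => // i;
        [move=> _|]; exact: wA.
    apply: eq_integral => w _; rewrite (eq_bigr (fun i =>
      (\1_(A i) (X i w))%:E)); last by move=> i _; rewrite (fA i).2.
    rewrite (prod_indic R A (fun i => X i w)) -EFinM; congr EFin.
    rewrite !indicE -natrM mulnb; congr ((nat_of_bool _)%:R).
    apply/idP/idP => [/andP[/set_mem Dw /asboolP wA]|/set_mem[Dw wA]].
      exact/mem_set.
    by apply/andP; split; [exact/mem_set|exact/asboolP].
  rewrite DX; last by move=> i; exact: (fA i).1.
  rewrite integral_indicM; apply: eq_integral => w _; congr (_ * _).
  apply: eq_bigr => i _; rewrite (fA i).2 integral_indic ?setIT//.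
  exact: (fA i).1.
pose i0 := Ordinal kN.
have mX i : measurable_fun [set: Omega] (f i \o X i).
  exact: measurableT_comp.
pose rho1 w := (\1_D w)%:E * \prod_(i < N | i != i0) f i (X i w).
pose rho2 w := (\1_D w)%:E *
  \prod_(i < N | i != i0) \int[(G w : probability R R)]_x f i x.
have mind : measurable_fun [set: Omega] (fun w => (\1_D w)%:E : \bar R).
  by apply/measurable_EFinP; exact: measurable_indic.
have rho10 w : 0 <= rho1 w by rewrite mule_ge0 ?lee_fin// prode_ge0.
have rho20 w : 0 <= rho2 w.
  by rewrite mule_ge0 ?lee_fin// prode_ge0// => i _; exact: integral_ge0.
have mrho1 : measurable_fun [set: Omega] rho1.
  by apply: emeasurable_funM => //; exact: emeasurable_prod_cond.
have mrho2 : measurable_fun [set: Omega] rho2.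
  apply: emeasurable_funM => //; apply: emeasurable_prod_cond => i.
  exact: measurable_random_integral.
have md (B : set R) : measurable B ->
    measurable_fun [set: Omega] (fun w => \d_(X i0 w) B : \bar R).
  move=> mB; apply/measurable_EFinP.
  by apply: (measurableT_comp (measurable_indic mB)).
have mG (B : set R) : measurable B -> measurable_fun [set: Omega]
    (fun w => ((G w : probability R R) : {measure set R -> \bar R}) B).
  exact: measurable_random_measure.
transitivity (\int[mixture P rho10 mrho1 md]_x f i0 x).
  rewrite ge0_integral_mixture//; apply: eq_integral => w _.
  rewrite integral_dirac// diracT mul1e (bigD1 i0)//= /rho1 -muleA.
  by congr (_ * _); rewrite muleC.
transitivity (\int[mixture P rho20 mrho2 mG]_x f i0 x); last first.
  rewrite ge0_integral_mixture//; apply: eq_integral => w _.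
  rewrite [in RHS](bigD1 i0)//= /rho2 -muleA.
  by congr (_ * _); rewrite muleC.
apply: eq_measure_integral => A mA _.
pose f' i := if i == i0 then fun x => (\1_A x)%:E else f i.
have := IH (ltnW kN) f'.
rewrite /mixture => H.
transitivity (\int[P]_w ((\1_D w)%:E * \prod_(i < N) f' i (X i w))).
  apply: eq_integral => w _; rewrite (bigD1 i0)//= {1}/f' eqxx.
  rewrite /rho1 muleAC -muleA; congr (_ * (_ * _)).
  by apply: eq_bigr => i /negbTE ii0; rewrite /f' ii0.
rewrite {}H.
- apply: eq_integral => w _; rewrite (bigD1 i0)//= {1}/f' eqxx.
  rewrite /rho2 muleAC -muleA integral_indic// setIT; congr (_ * (_ * _)).
  by apply: eq_bigr => i /negbTE ii0; rewrite /f' ii0.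
- by move=> i x; rewrite /f'; case: ifP.
- move=> i; rewrite /f'; case: ifP => // _.
  by apply/measurable_EFinP; exact: measurable_indic.
- move=> i ki; rewrite /f'; case: eqP => [_|/eqP ii0]; first by exists A.
  by apply: fA; rewrite ltn_neqAle ki andbT eq_sym.
Qed.

End conditionally_iid.

(** * Ties in a sample *)
Definition ker_partition (I : finType) (T : eqType) (x : I -> T) :
  {set {set I}} := preim_partition x [set: I]%SET.

Lemma pblock_ker_partition (I : finType) (T : eqType) (x : I -> T) (i j : I) :
  (finset.pblock (ker_partition x) i == finset.pblock (ker_partition x) j) =
  (x i == x j).
Proof.
have /and3P[/eqP covp tip _] := preim_partitionP x [set: I]%SET.
rewrite eq_pblock ?covp ?inE// pblock_equivalence_partition ?inE//.
by split => // /eqP ->.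
Qed.

Lemma ker_partitionP (I : finType) (T : eqType) (x : I -> T)
    (p : {set {set I}}) : finset.partition p [set: I]%SET ->
  ker_partition x = p <->
  forall i j, (x i == x j) = (finset.pblock p i == finset.pblock p j).
Proof.
move=> partp; split => [<- i j|xp]; first by rewrite pblock_ker_partition.
rewrite -(preim_partition_pblock partp) /ker_partition.
by apply: eq_in_imset => i _; apply/setP => j; rewrite !inE xp.
Qed.

Lemma measurable_ker_partition (R : realType) M (p : {set {set 'I_M}}) :
  finset.partition p [set: 'I_M]%SET ->
  measurable [set x : M.-tuple R | ker_partition (tnth x) = p].
Proof.
move=> partp.
have mE (i j : 'I_M) (b : bool) :
    measurable [set x : M.-tuple R | (tnth x i == tnth x j) = b].
  rewrite -[X in measurable X]setTI.
  have := measurable_fun_eqr (@measurable_tnth _ R M i) (@measurable_tnth _ R M j).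
  by move=> /(_ measurableT [set b]); exact.
rewrite [X in measurable X](_ : _ = \bigcap_(ij in [set: 'I_M * 'I_M])
    [set x : M.-tuple R | (tnth x ij.1 == tnth x ij.2) =
      (finset.pblock p ij.1 == finset.pblock p ij.2)]).
  by apply: fin_bigcap_measurable => // ij _; exact: mE.
apply/seteqP; split => [x /= /(ker_partitionP _ partp) xp [i j] _ /=|x xp].
  exact: xp.
by apply/(ker_partitionP _ partp) => i j; exact: (xp (i, j)).
Qed.

Lemma measurable_not_uniq (R : realType) k :
  measurable [set u : k.-tuple R | ~~ uniq u].
Proof.
rewrite [X in measurable X](_ : _ = \bigcup_(ij in [set ij : 'I_k * 'I_k |
    ij.1 != ij.2]) [set u : k.-tuple R | tnth u ij.1 == tnth u ij.2]).
  apply: fin_bigcup_measurable => // ij _; rewrite -[X in measurable X]setTI.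
  have := measurable_fun_eqr (@measurable_tnth _ R k ij.1)
    (@measurable_tnth _ R k ij.2).
  by move=> /(_ measurableT [set true]); exact.
apply/seteqP; split => [u /= nu|].
  apply: contrapT => Hu; move/negP: nu; apply; apply/tuple_uniqP => i j uij.
  by apply: contrapT => /eqP ij; apply: Hu; exists (i, j) => //=; rewrite uij.
move=> u [[i j] /= /eqP ij /eqP uij]; apply/negP => /tuple_uniqP uinj.
by apply: ij; exact: uinj.
Qed.

(** A finite set is null for a law without atoms; this is what makes a sample
    from it almost surely free of ties. *)
Lemma nonatomic_seq (R : realType) (H : probability R R) (s : seq R) :
  nonatomic H -> H [set x | x \in s] = 0.
Proof.
move=> H0; elim: s => [|a s IH].
  by rewrite (_ : [set x | _] = set0) ?measure0//; apply/seteqP; split.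
rewrite (_ : [set x | _] = [set a] `|` [set x | x \in s]).
  have ms : measurable [set x | x \in s].
    apply: countable_measurable => //.
    exact/finite_set_countable/finite_seq.
  by rewrite measureU0//; exact: H0.
apply/seteqP; split => x /=; rewrite inE.
  by move=> /orP[/eqP ->|]; [left|right].
by move=> [->|->]; rewrite ?eqxx ?orbT.
Qed.

Lemma tuple_prod_uniq (R : realType) (H : probability R R) k :
  nonatomic H ->
  tuple_prod (nseq k H) [set u : (size (nseq k H)).-tuple R | ~~ uniq u] = 0.
Proof.
move=> H0; elim: k => [|k IH].
  rewrite (_ : [set u | _] = set0) ?measure0//.
  by apply/seteqP; split => // u /=; rewrite (tuple0 u).
set E := [set u : (size (nseq k H)).-tuple R | ~~ uniq u] in IH *.
have mE : measurable E by exact: measurable_not_uniq.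
have mE' : measurable [set u : (size (nseq k.+1 H)).-tuple R | ~~ uniq u].
  exact: measurable_not_uniq.
rewrite -(setIT [set u : _.-tuple R | ~~ uniq u]) -integral_indic//.
rewrite [LHS]ge0_integral_distribution//; last first.
  by apply/measurable_EFinP; exact: measurable_indic.
rewrite (fubini_tonelli2 (_ \o _)); last 2 first.
- apply: measurableT_comp; last exact: measurable_cons_pair.
  by apply/measurable_EFinP; exact: measurable_indic.
- by move=> x; rewrite lee_fin.
rewrite -[RHS]IH -(setIT E) -integral_indic//; apply: eq_integral => u _.
rewrite /fubini_G /= /cons_pair.
have [uu|uu] := boolP (uniq u).
  rewrite [RHS](_ : _ = 0); last by rewrite indicE memNset//= /E /= uu.
  transitivity (\int[H]_x (\1_[set y | y \in (u : seq R)] x)%:E).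
    apply: eq_integral => x _; rewrite !indicE; congr ((nat_of_bool _)%:R%:E).
    apply/idP/idP => [/set_mem/=|/set_mem /= xu]; last first.
      by apply/mem_set; rewrite /= xu.
    by rewrite uu andbT negbK => xu; apply/mem_set.
  rewrite integral_indic// ?setIT; first exact: nonatomic_seq.
  apply: countable_measurable => //.
  exact/finite_set_countable/finite_seq.
rewrite [RHS](_ : _ = 1); last by rewrite indicE mem_set.
transitivity (\int[H]_x cst 1 x); last first.
  by rewrite integral_cst// mul1e; exact: probability_setT.
apply: eq_integral => x _; rewrite indicE mem_set//=.
by rewrite negb_and uu orbT.
Qed.

(** [partition_law H p] is the law of a sample whose values are drawn from [H]
    independently, one for each cell of [p]. *)
Section partition_law.
Context (R : realType).

Definition spread k M (lab : 'I_M -> nat) (u : k.-tuple R) : M.-tuple R :=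
  [tuple nth 0%R u (lab i) | i < M].

Lemma measurable_nth_tuple k j :
  measurable_fun [set: k.-tuple R] (fun u => nth 0%R u j).
Proof.
have [jk|kj] := ltnP j k; last first.
  rewrite [X in measurable_fun _ X](_ : _ = cst 0%R)//.
  by apply/funext => u; rewrite nth_default// size_tuple.
rewrite [X in measurable_fun _ X](_ : _ = (@tnth _ _ ^~ (Ordinal jk))).
  exact: measurable_tnth.
by apply/funext => u; rewrite (tnth_nth 0%R).
Qed.

Lemma measurable_spread k M (lab : 'I_M -> nat) :
  measurable_fun [set: k.-tuple R] (spread lab).
Proof.
apply/measurable_fun_tnthP => i.
apply: (eq_measurable_fun (fun u : k.-tuple R => nth 0%R u (lab i))).
  by move=> u _ /=; rewrite tnth_mktuple.
exact: measurable_nth_tuple.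
Qed.

HB.instance Definition _ k M (lab : 'I_M -> nat) :=
  isMeasurableFun.Build _ _ _ _ (@spread k M lab) (@measurable_spread k M lab).

Variable H : probability R R.

Definition partition_law M (p : {set {set 'I_M}}) : probability (M.-tuple R) R :=
  distribution (tuple_prod (nseq #|p| H))
    (spread (fun i => index (finset.pblock p i) (enum p))).

Lemma ge0_integral_partition_law M (p : {set {set 'I_M}})
    (f : 'I_M -> R -> \bar R) :
  finset.partition p [set: 'I_M]%SET ->
  (forall i x, 0 <= f i x) -> (forall i, measurable_fun [set: R] (f i)) ->
  \int[partition_law p]_x \prod_(i < M) f i (tnth x i) =
  \prod_(C in p) \int[H]_x \prod_(i in C) f i x.
Proof.
move=> /and3P[/eqP covp tip _] f0 mf.
have labp i : (index (finset.pblock p i) (enum p) < #|p|)%N.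
  by rewrite cardE index_mem mem_enum pblock_mem// covp inE.
rewrite ge0_integral_distribution//; last 2 first.
- apply: emeasurable_prod => i.
  by apply: (measurableT_comp (mf i)); exact: measurable_tnth.
- by move=> x; exact: prode_ge0.
(* The factors are grouped by cell, cells being numbered as in [enum p]. *)
pose F c x := \prod_(i < M | index (finset.pblock p i) (enum p) == c) f i x.
transitivity (\int[tuple_prod (nseq #|p| H)]_u
    \prod_(c < size (nseq #|p| H)) F c (tnth u c)).
  apply: eq_integral => u _ /=.
  have labs i : (index (finset.pblock p i) (enum p) < size (nseq #|p| H))%N.
    by rewrite size_nseq.
  rewrite (partition_big (fun i => Ordinal (labs i)) xpredT)//=.
  apply: eq_bigr => c _; apply: eq_big => [i|i /eqP <-]; first by rewrite -val_eqE.
  by rewrite tnth_mktuple (tnth_nth 0%R).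
rewrite (ge0_integral_tuple_prod H); last 2 first.
- by move=> c x; exact: prode_ge0.
- by move=> c; exact: emeasurable_prod_cond.
rewrite -(big_mkord xpredT (fun c => \int[nth H (nseq #|p| H) c]_x F c x)).
rewrite size_nseq -[RHS]big_enum/= (big_nth finset.set0) -cardE.
rewrite big_nat [RHS]big_nat; apply: eq_bigr => c /andP[_ cp].
rewrite nth_nseq cp; apply: eq_integral => x _; apply: eq_bigl => i.
have cE : (c < size (enum p))%N by rewrite -cardE.
have nthp : nth finset.set0 (enum p) c \in p by rewrite -mem_enum mem_nth.
apply/eqP/idP => [<-|ic].
  rewrite nth_index ?mem_pblock ?covp ?inE//.
  by rewrite mem_enum pblock_mem// covp inE.
by rewrite (def_pblock tip nthp ic) index_uniq// enum_uniq.
Qed.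

Lemma partition_law_rectangle M (p : {set {set 'I_M}}) (A : 'I_M -> set R) :
  finset.partition p [set: 'I_M]%SET -> (forall i, measurable (A i)) ->
  partition_law p [set x | forall i, A i (tnth x i)] =
  \prod_(C in p) H (\bigcap_(i in [set` C]) A i).
Proof.
move=> partp mA; set E := [set x | _].
have mE : measurable E by exact: measurable_rectangle.
rewrite -(setIT E) -integral_indic//.
transitivity (\int[partition_law p]_x \prod_(i < M) (\1_(A i) (tnth x i))%:E).
  apply: eq_integral => x _; rewrite (prod_indic R A (tnth x)).
  rewrite indicE; congr ((nat_of_bool _)%:R%:E).
rewrite (ge0_integral_partition_law (f := fun i x => (\1_(A i) x)%:E))//; last first.
  by move=> i; apply/measurable_EFinP; exact: measurable_indic.
apply: eq_bigr => C _; rewrite -[in RHS](setIT (\bigcap_(i in _) _)).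
have mC : measurable (\bigcap_(i in [set` C]) A i).
  by apply: fin_bigcap_measurable.
rewrite -integral_indic//; apply: eq_integral => x _.
rewrite indicE; case: (boolP (_ \in _)) => [/set_mem xA|xA].
  by rewrite big1// => i iC; rewrite indicE mem_set//; exact: xA.
have /existsNP[i /not_implyP[iC xAi]] : ~ (\bigcap_(i in [set` C]) A i) x.
  by move=> /mem_set; exact/negP.
by rewrite (bigD1 i)//= indicE memNset// mul0e.
Qed.

(** Distinct cells almost surely get distinct values. *)
Lemma partition_law_ker M (p : {set {set 'I_M}}) :
  nonatomic H -> finset.partition p [set: 'I_M]%SET ->
  partition_law p [set x | ker_partition (tnth x) <> p] = 0.
Proof.
move=> H0 partp; have /and3P[/eqP covp tip _] := partp.
have mK := @measurable_ker_partition R _ _ partp.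
apply: (subset_measure0 _ _ _ (tuple_prod_uniq #|p| H0)).
- rewrite -[X in measurable X]setTI; apply: measurable_spread => //.
  exact: measurableC.
- exact: measurable_not_uniq.
move=> u /=; apply: contra_notN => uu.
have usz : size u = #|p| by rewrite size_tuple size_nseq.
apply/(ker_partitionP _ partp) => i j; rewrite !tnth_mktuple.
have inp k : finset.pblock p k \in enum p.
  by rewrite mem_enum pblock_mem// covp inE.
rewrite nth_uniq ?usz ?cardE ?index_mem//.
apply/eqP/eqP => [ij|->//].
by rewrite -(nth_index finset.set0 (inp i)) ij nth_index.
Qed.

End partition_law.

(** * The law of a sample from a species sampling model *)
Lemma finite_sum_measure d (T : measurableType d) (R : realType) (I : Type)
    (s : seq I) (m : I -> {measure set T -> \bar R}) :
  exists2 mu : {measure set T -> \bar R},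
    (forall A, mu A = \sum_(i <- s) m i A) &
    forall f : T -> \bar R, (forall x, 0 <= f x) ->
      measurable_fun [set: T] f ->
      \int[mu]_x f x = \sum_(i <- s) \int[m i]_x f x.
Proof.
elim: s => [|i s [mu muE mu_int]].
  exists mzero => [A|f f0 mf]; first by rewrite big_nil.
  by rewrite big_nil integral_measure_zero.
exists (measure_add (m i) mu) => [A|f f0 mf].
  by rewrite big_cons -muE; exact: measure_addE.
by rewrite big_cons -mu_int// ge0_integral_measure_add.
Qed.

Section sample_law.
Context d (Omega : measurableType d) (R : realType).
Variables (P : probability Omega R) (H : probability R R)
  (G : {RV P >-> pprobability R R}) (chi : seq nat -> R).

HB.instance Definition _ M (X : 'I_M -> {RV P >-> R}) :=
  isMeasurableFun.Build _ _ _ _ (sample_tuple X) (measurable_sample_tuple X).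

(** The marginal law of a conditionally i.i.d. sample from [G]. *)
Definition sampled_from M (X : 'I_M -> {RV P >-> R}) :=
  forall A : 'I_M -> set R, (forall i, measurable (A i)) ->
    P [set w | forall i, A i (X i w)] =
    \int[P]_w \prod_(i < M) (G w : probability R R) (A i).

Hypotheses (H0 : nonatomic H) (Gchi : is_eppf H G chi).

Lemma eppf_ge0 (I : finType) (p : {set {set I}}) :
  finset.partition p [set: I]%SET -> (0 <= chi (cell_sizes p))%R.
Proof.
move=> /and3P[_ _ p0]; have [_ chi0 _ _] := Gchi; apply: chi0.
apply/allP => _ /mapP[C + ->]; rewrite mem_enum => Cp.
by rewrite card_gt0; apply: contraNneq p0 => <-.
Qed.

Variables (M : nat) (X : 'I_M -> {RV P >-> R}).
Hypothesis GX : sampled_from X.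

(** Both sides are finite measures, and the defining property of [chi] says that
    they agree on rectangles. *)
Lemma sample_law B : measurable B ->
  P (sample_tuple X @^-1` B) =
  \sum_(p : {set {set 'I_M}} | finset.partition p [set: 'I_M]%SET)
    (chi (cell_sizes p))%:E * partition_law H p B.
Proof.
move=> mB.
pose s := [seq p : {set {set 'I_M}} <- index_enum _ |
  finset.partition p [set: 'I_M]%SET].
have [mu muE _] := finite_sum_measure s (fun p : {set {set 'I_M}} =>
  mscale (NngNum (normr_ge0 (chi (cell_sizes p)))) (partition_law H p)).
(* The absolute value makes the weight nonnegative for every [p]; it equals
   [chi] when [p] is a partition. *)
transitivity (mu B); last first.
  rewrite muE big_filter; apply: eq_bigr => p partp.
  by rewrite -[LHS]/(_ * _)/= ger0_norm// eppf_ge0.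
apply: (@tuple_measure_unique _ _ _ _ (distribution P (sample_tuple X)) mu) => //.
  by rewrite [X in X < _]probability_setT ltry.
move=> A mA; rewrite muE big_filter.
transitivity (P [set w | forall i, A i (X i w)]).
  congr (P _); apply/seteqP; split => w wA i; have := wA i;
    by rewrite tnth_mktuple.
have [_ _ _ chiM] := Gchi; rewrite GX// chiM//; apply: eq_bigr => p partp.
rewrite -[RHS]/(_ * _)/= ger0_norm ?eppf_ge0//.
by rewrite partition_law_rectangle.
Qed.

(** The laws that compose [sample_law] live on disjoint events: the tie
    partition tells from which of them the sample comes. *)
Lemma sample_law_ker (p : {set {set 'I_M}}) B :
  finset.partition p [set: 'I_M]%SET -> measurable B ->
  P (sample_tuple X @^-1` ([set x | ker_partition (tnth x) = p] `&` B)) =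
  (chi (cell_sizes p))%:E * partition_law H p B.
Proof.
move=> partp mB; have mK := @measurable_ker_partition R _ _ partp.
rewrite sample_law; last exact: measurableI.
rewrite (bigD1 p)//= big1 ?adde0; last first.
  move=> q /andP[partq qp]; rewrite (subset_measure0 _ _ _
    (partition_law_ker H0 partq)) ?mule0//.
  - exact: measurableI.
  - by apply: measurableC; exact: measurable_ker_partition.
  by move=> x [/= -> _]; apply/eqP; rewrite eq_sym.
congr (_ * _); set K := [set x | _] in mK *.
rewrite -[in RHS](setUIDK B K) [in RHS]measureU0 1?setIC//.
- exact: measurableI.
- exact: measurableD.
- apply: (subset_measure0 _ _ _ (partition_law_ker H0 partp)).
  + exact: measurableD.
  + exact: (measurableC mK).
  + by move=> x [].
Qed.

Lemma eppfE (p : {set {set 'I_M}}) : finset.partition p [set: 'I_M]%SET ->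
  (chi (cell_sizes p))%:E =
  P (sample_tuple X @^-1` [set x | ker_partition (tnth x) = p]).
Proof.
move=> partp; rewrite -[RHS](_ : P (sample_tuple X @^-1`
    ([set x | ker_partition (tnth x) = p] `&` setT)) = _); last by rewrite setIT.
by rewrite sample_law_ker// probability_setT mule1.
Qed.

Lemma ge0_integral_sample_ker (p : {set {set 'I_M}}) (F : M.-tuple R -> \bar R) :
  finset.partition p [set: 'I_M]%SET ->
  (forall x, 0 <= F x) -> measurable_fun [set: M.-tuple R] F ->
  \int[P]_w ((ker_partition (tnth (sample_tuple X w)) == p)%:R%:E *
    F (sample_tuple X w)) =
  (chi (cell_sizes p))%:E * \int[partition_law H p]_x F x.
Proof.
move=> partp F0 mF; have mK := @measurable_ker_partition R _ _ partp.
set K := [set x | _] in mK.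
have i0 x : 0 <= (\1_K x)%:E :> \bar R by rewrite lee_fin.
have mi : measurable_fun [set: M.-tuple R] (fun x => (\1_K x)%:E : \bar R).
  by apply/measurable_EFinP; exact: measurable_indic.
have -> : (chi (cell_sizes p))%:E * \int[partition_law H p]_x F x =
  \int[mscale (NngNum (eppf_ge0 partp)) (partition_law H p)]_x F x.
  by rewrite ge0_integral_mscale.
transitivity (\int[mdensity (distribution P (sample_tuple X)) i0 mi]_x F x).
  rewrite ge0_integral_mdensity// [RHS]ge0_integral_distribution//.
  - apply: eq_integral => w _ /=; congr (_ * _).
    rewrite indicE; congr ((nat_of_bool _)%:R%:E).
    by apply/eqP/idP => [?|/set_mem]//; exact/mem_set.
  - exact: emeasurable_funM.
  - by move=> x; rewrite mule_ge0.
apply: eq_measure_integral => A mA _.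
transitivity (P (sample_tuple X @^-1` (K `&` A))).
  transitivity (\int[distribution P (sample_tuple X)]_(x in A) (\1_K x)%:E) => //.
  by rewrite integral_indic.
by rewrite sample_law_ker.
Qed.

End sample_law.

(** * The mixture model *)
Lemma kern0 (R : realType) (theta s : R) : kern theta 0 s = 0%R.
Proof. by rewrite /kern invr0 mul0r. Qed.

Lemma integral_kern (R : realType) (theta x : R) :
  \int[lebesgue_measure]_(s in [set: R]) (kern theta x s)%:E =
  (x != 0%R)%:R%:E.
Proof.
have mlt (k : R) (i : interval R) : (0 <= k)%R ->
    (forall s, kern theta x s = (k * \1_[set` i] s)%R) ->
    \int[lebesgue_measure]_(s in [set: R]) (kern theta x s)%:E =
    k%:E * lebesgue_measure [set` i].
  move=> k0 kE; under eq_integral do rewrite kE EFinM.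
  rewrite ge0_integralZl_EFin//; last first.
    by apply/measurable_EFinP; exact: measurable_indic.
  by rewrite integral_indic// setIT.
have [->|x0] := eqVneq x 0%R.
  by rewrite integral0_eq// => s _; rewrite kern0.
have [xpos|xneg] := ltrP 0%R x.
  rewrite (mlt x^-1%R `]theta, (theta + x)%R]); last 2 first.
  - by rewrite invr_ge0 ltW.
  - move=> s; rewrite /kern; congr (_ * _)%R.
    rewrite (_ : (x <= s - theta < 0)%R = false) ?subr0.
      rewrite indicE; congr ((nat_of_bool _)%:R)%R.
      by rewrite mem_setE in_itv/= subr_gt0 lerBlDl.
    by apply/negbTE/negP => /andP[xs s0]; move: (lt_le_trans xpos xs); lra.
  rewrite lebesgue_measure_itv/= lte_fin ltrDl xpos -EFinD -EFinM.
  by congr EFin; rewrite addrAC subrr add0r mulVf.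
have {}xneg : (x < 0)%R by rewrite lt_neqAle x0.
rewrite (mlt (- x^-1)%R `[(theta + x)%R, theta[); last 2 first.
- by rewrite oppr_ge0 invr_le0 ltW.
- move=> s; rewrite /kern mulNr -mulrN; congr (_ * _)%R.
  rewrite (_ : (0 < s - theta <= x)%R = false) ?sub0r.
    congr (- _)%R; rewrite indicE; congr ((nat_of_bool _)%:R)%R.
    by rewrite mem_setE in_itv/= subr_lt0 lerBrDl.
  by apply/negbTE/negP => /andP[xs s0]; move: (lt_le_trans xs s0); lra.
rewrite lebesgue_measure_itv/= lte_fin gtrDl xneg -EFinB -EFinM.
by congr EFin; rewrite opprD addrA subrr add0r mulrNN mulVf.
Qed.

Section model_law.
Context d (Omega : measurableType d) (R : realType).
Variables (P : probability Omega R) (H : probability R R)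
  (G : {RV P >-> pprobability R R}) (chi : seq nat -> R).
Hypotheses (H0 : nonatomic H) (Gchi : is_eppf H G chi).

(** The mean of [G] is [H], which has no atoms. *)
Lemma random_measure_null (a : R) :
  ae_eq P [set: Omega] (fun w => (G w : probability R R) [set a]) (cst 0).
Proof.
have mGa : measurable_fun [set: Omega]
    (fun w => (G w : probability R R) [set a]).
  exact: measurable_random_measure.
apply/(ae_eq_integral_abs P measurableT mGa).
transitivity (\int[P]_w \prod_(i < 1) (G w : probability R R) [set a]).
  by apply: eq_integral => w _; rewrite big_ord1 gee0_abs.
have [_ _ _ chiM] := Gchi; rewrite (chiM 1%N (fun=> [set a]))//.
rewrite big1// => p /and3P[/eqP covp _ _].
have pp : finset.pblock p ord0 \in p by rewrite pblock_mem// covp inE.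
rewrite (bigD1 _ pp)/= (_ : H _ = 0) ?mul0e ?mule0//.
apply: (subset_measure0 _ _ _ (H0 a)) => //.
- exact: fin_bigcap_measurable.
- by move=> x /(_ ord0); apply; rewrite /= mem_pblock covp inE.
Qed.

Variables (theta : R) (N : nat) (X T : 'I_N -> {RV P >-> R}).
Hypothesis model : mixture_model G theta X T.

(** The density of [T] given [X = x] integrates to [1] except when [x] is [0],
    a value that [G] almost surely does not charge. *)
Lemma joint_law (B : set (pprobability R R)) (A : 'I_N -> set R) :
  measurable B -> (forall i, measurable (A i)) ->
  P [set w | (G @^-1` B) w /\ forall i, A i (X i w)] =
  \int[P]_(w in G @^-1` B) \prod_(i < N) (G w : probability R R) (A i).
Proof.
move=> mB mA; have := @model B A (fun=> setT) mB mA (fun=> measurableT).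
have -> : [set w | [/\ B (G w), forall i, A i (X i w) &
    forall i, [set: R] (T i w)]] =
    [set w | (G @^-1` B) w /\ forall i, A i (X i w)].
  by apply/seteqP; split => [w []|w []].
move=> ->.
have mGB : measurable (G @^-1` B).
  by rewrite -[X in measurable X]setTI; exact: (measurable_funPT G).
transitivity (\int[P]_(w in G @^-1` B)
    \prod_(i < N) (G w : probability R R) (A i `\ 0%R)).
  apply: eq_integral => w _; apply: eq_bigr => i _.
  under eq_integral do rewrite integral_kern.
  rewrite [RHS](_ : _ = (G w : probability R R) (~` [set 0%R] `&` A i)); last first.
    by rewrite setIC.
  rewrite -integral_indic//; last exact: measurableC.
  apply: eq_integral => x _; rewrite indicE; congr ((nat_of_bool _)%:R%:E).
  by apply/idP/idP => [/eqP x0|/set_mem /eqP//]; apply/mem_set.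
apply: ae_eq_integral => //.
- apply: measurable_funTS; apply: emeasurable_prod => i.
  by apply: measurable_random_measure; exact: measurableD.
- apply: measurable_funTS; apply: emeasurable_prod => i.
  exact: measurable_random_measure.
have := random_measure_null 0; apply: filterS => w /= /(_ I) G0 _.
apply: eq_bigr => i _; rewrite -[in RHS](setUIDK (A i) [set 0%R]) setUC.
rewrite measureU0//; [exact: measurableD|exact: measurableI|].
by apply: (subset_measure0 _ _ _ G0) => //; exact: measurableI.
Qed.

Lemma integral_kernels (B : set (pprobability R R)) (f : 'I_N -> R -> \bar R) :
  measurable B -> (forall i x, 0 <= f i x) ->
  (forall i, measurable_fun [set: R] (f i)) ->
  \int[P]_(w in G @^-1` B) \prod_(i < N) f i (X i w) =
  \int[P]_(w in G @^-1` B)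
    \prod_(i < N) \int[(G w : probability R R)]_x f i x.
Proof.
move=> mB; apply: conditionally_iid_integral.
  by rewrite -[X in measurable X]setTI; exact: (measurable_funPT G).
by move=> A mA; exact: joint_law.
Qed.

(** Coordinates outside the subsample are left unconstrained, and cost a factor
    [1]. *)
Lemma sampled_from_sub M (f : 'I_M -> 'I_N) : injective f ->
  sampled_from G (fun i => X (f i)).
Proof.
move=> finj A mA.
(* [A' (f i)] is [A i], and [A' j] is everything off the image of [f]. *)
pose A' j := \bigcap_(i in [set i | f i = j]) A i.
have mA' j : measurable (A' j) by exact: fin_bigcap_measurable.
have A'f i : A' (f i) = A i.
  apply/seteqP; split => [x /(_ i)|x xA i' /= /finj -> //]; exact.
have := joint_law measurableT mA'; rewrite preimage_setT => joint.
transitivity (P [set w | [set: Omega] w /\ forall i, A' i (X i w)]).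
  congr (P _); apply/seteqP; split => [w wA|w [_ wA'] i].
    by split=> // j i /= <-; exact: wA.
  by rewrite -A'f.
rewrite joint; apply: eq_integral => w _.
rewrite (bigID (mem (f @: [set: 'I_M])%SET))/= [X in _ * X]big1 ?mule1.
  rewrite big_imset/=; last by move=> i j _ _; exact: finj.
  by apply: eq_big => [i|i _]; rewrite ?inE// A'f.
move=> j jf; rewrite (_ : A' j = setT) ?probability_setT//.
apply/seteqP; split => // x _ i /= fij; move: jf.
by rewrite -fij imset_f ?inE.
Qed.

Lemma exchangeable (s : {perm 'I_N}) (B : set (pprobability R R))
    (F : N.-tuple R -> \bar R) :
  measurable B -> (forall x, 0 <= F x) ->
  measurable_fun [set: N.-tuple R] F ->
  \int[P]_(w in G @^-1` B) F (sample_tuple (fun i => X (s i)) w) =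
  \int[P]_(w in G @^-1` B) F (sample_tuple X w).
Proof.
move=> mB F0 mF.
have mGB : measurable (G @^-1` B).
  by rewrite -[X in measurable X]setTI; exact: (measurable_funPT G).
have i0 w : 0 <= (\1_(G @^-1` B) w)%:E :> \bar R by rewrite lee_fin.
have mi : measurable_fun [set: Omega] (fun w => (\1_(G @^-1` B) w)%:E : \bar R).
  by apply/measurable_EFinP; exact: measurable_indic.
have md (Y : 'I_N -> {RV P >-> R}) (A : set (N.-tuple R)) : measurable A ->
    measurable_fun [set: Omega] (fun w => \d_(sample_tuple Y w) A : \bar R).
  move=> mA; apply/measurable_EFinP.
  by apply: (measurableT_comp (measurable_indic mA));
    exact: measurable_sample_tuple.
have mixE (Y : 'I_N -> {RV P >-> R}) :
    \int[P]_(w in G @^-1` B) F (sample_tuple Y w) =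
    \int[mixture P i0 mi (md Y)]_x F x.
  rewrite integral_indicM ge0_integral_mixture//; apply: eq_integral => w _.
  by rewrite integral_dirac// diracT mul1e.
rewrite 2!mixE; apply: eq_measure_integral => C mC _.
have mixR (Y : 'I_N -> {RV P >-> R}) (A : 'I_N -> set R) :
    (forall i, measurable (A i)) ->
    mixture P i0 mi (md Y) [set x | forall i, A i (tnth x i)] =
    P [set w | (G @^-1` B) w /\ forall i, A i (Y i w)].
  move=> mA; rewrite /mixture.
  pose E := [set w | (G @^-1` B) w /\ forall i, A i (Y i w)].
  have mE : measurable E.
    rewrite [X in measurable X](_ : _ = G @^-1` B `&`
        sample_tuple Y @^-1` [set x | forall i, A i (tnth x i)]).
      apply: measurableI => //; rewrite -[X in measurable X]setTI.
      by apply: measurable_sample_tuple => //; exact: measurable_rectangle.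
    by apply/seteqP; split => w [Bw wA]; split => // i; have := wA i;
      rewrite tnth_mktuple.
  rewrite -/E -(setIT E) -integral_indic//; apply: eq_integral => w _.
  rewrite /= /dirac -EFinM !indicE -natrM mulnb; congr ((nat_of_bool _)%:R%:E).
  apply/idP/idP => [/andP[/set_mem Bw /set_mem/= wA]|/set_mem[Bw wA]].
    by apply/mem_set; split => // i; have := wA i; rewrite tnth_mktuple.
  by apply/andP; split; apply/mem_set => //= i; rewrite tnth_mktuple.
apply: tuple_measure_unique mC.
- rewrite [X in X < _](_ : _ = P (G @^-1` B)) ?ltey_eq ?fin_num_measure//.
  have -> : [set: N.-tuple R] = [set x | forall i, [set: R] (tnth x i)].
    by apply/seteqP; split.
  apply: (eq_trans (y := P _)); first exact: (mixR _ (fun=> setT)).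
  by congr (P _); apply/seteqP; split => w // [].
move=> A mA; apply: (eq_trans (y := P _)); first exact: mixR.
apply/esym; apply: (eq_trans (y := P _)); first exact: mixR.
rewrite joint_law//.
have := @joint_law B (fun j => A ((s^-1)%g j)) mB (fun j => mA _).
have -> : [set w | (G @^-1` B) w /\ forall i, A ((s^-1)%g i) (X i w)] =
    [set w | (G @^-1` B) w /\ forall i, A i (X (s i) w)].
  apply/seteqP; split => w [Bw wA]; split => // i.
    by have := wA (s i); rewrite permK.
  by have := wA ((s^-1)%g i); rewrite permKV.
move=> ->; apply: eq_integral => w _.
exact: (reindex_inj (@perm_inj _ (s^-1)%g)).
Qed.

End model_law.

(** * Partitions and S-paths *)
Section tops.
Variable n : nat.
Implicit Types (p : {set {set 'I_n}}) (S : {ffun 'I_n.+1 -> 'I_n.+1}).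

Section partition.
Variable p : {set {set 'I_n}}.
Hypothesis partp : finset.partition p [set: 'I_n]%SET.

Let covp : finset.cover p = [set: 'I_n]%SET.
Proof. by have /and3P[/eqP] := partp. Qed.

Let tip : finset.trivIset p.
Proof. by have /and3P[] := partp. Qed.

Lemma top_of_cellP i : top_of_cell p i \in finset.pblock p i /\
  forall k, k \in finset.pblock p i -> (k <= top_of_cell p i)%N.
Proof.
rewrite /top_of_cell; case: arg_maxnP => [|k ik kmax]; last by split.
by rewrite mem_pblock covp inE.
Qed.

Lemma leq_top_of_cell (i : 'I_n) : (i <= top_of_cell p i)%N.
Proof. by apply: (top_of_cellP i).2; rewrite mem_pblock covp inE. Qed.

Lemma pblock_top_of_cell i :
  finset.pblock p (top_of_cell p i) = finset.pblock p i.
Proof. exact: same_pblock tip (top_of_cellP i).1. Qed.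

Lemma eq_top_of_cell i j : (top_of_cell p i == top_of_cell p j) =
  (finset.pblock p i == finset.pblock p j).
Proof.
apply/eqP/eqP => [ij|ij].
  by rewrite -pblock_top_of_cell ij pblock_top_of_cell.
apply: val_inj; apply/eqP; rewrite eqn_leq /=.
have [ii imax] := top_of_cellP i; have [jj jmax] := top_of_cellP j.
by apply/andP; split; [apply: jmax; rewrite -ij|apply: imax; rewrite ij].
Qed.

Lemma top_of_cellK i : top_of_cell p (top_of_cell p i) = top_of_cell p i.
Proof. by apply/eqP; rewrite eq_top_of_cell pblock_top_of_cell. Qed.

Lemma ker_top_of_cell : ker_partition (top_of_cell p) = p.
Proof. by apply/ker_partitionP => // i j; exact: eq_top_of_cell. Qed.

Lemma is_topE C i : C \in p ->
  is_top C i = (C == finset.pblock p i) && (top_of_cell p i == i).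
Proof.
move=> Cp; apply/andP/andP => [[iC /forall_inP imax]|[/eqP -> /eqP ti]].
  have CE : finset.pblock p i = C by exact: def_pblock.
  rewrite CE eqxx; split => //; apply/eqP/val_inj/eqP.
  rewrite /= eqn_leq leq_top_of_cell andbT; apply: imax.
  by rewrite -CE; exact: (top_of_cellP i).1.
split; first by rewrite mem_pblock covp inE.
apply/forall_inP => k ki; rewrite -[X in (_ <= nat_of_ord X)%N]ti.
exact: (top_of_cellP i).2.
Qed.

Lemma exists_is_top i : [exists C in p, is_top C i] = (top_of_cell p i == i).
Proof.
have ip : finset.pblock p i \in p by rewrite pblock_mem// covp inE.
apply/exists_inP/idP => [[C Cp]|ti]; first by rewrite is_topE// => /andP[].
by exists (finset.pblock p i); rewrite // is_topE// eqxx.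
Qed.

(** The size of the cell with largest element [i], and [0] if there is none. *)
Definition fiber_size i := #|[set k | top_of_cell p k == i]%SET|.

Lemma fiber_size_top i : top_of_cell p i = i ->
  fiber_size i = #|finset.pblock p i|.
Proof.
move=> ti; apply: eq_card => k; rewrite inE -[X in _ == X]ti eq_top_of_cell.
by rewrite eq_pblock ?covp ?inE// -eq_pblock ?covp ?inE// eq_sym eq_pblock ?covp ?inE.
Qed.

Lemma fiber_size_eq0 i : top_of_cell p i != i -> fiber_size i = 0%N.
Proof.
move=> ti; apply/eqP; rewrite cards_eq0; apply: contraNT ti => /set0Pn[k].
by rewrite inE => /eqP <-; rewrite top_of_cellK.
Qed.

(** The coordinate [j] counts the points whose cell lies below [j]; this is the
    only candidate, as a path is the cumulative sum of its increments. *)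
Definition path_of : {ffun 'I_n.+1 -> 'I_n.+1} :=
  [ffun j : 'I_n.+1 => inord #|[set k | (top_of_cell p k < j)%N]%SET|].

Lemma path_ofE j : path_of j = #|[set k | (top_of_cell p k < j)%N]%SET| :> nat.
Proof.
by rewrite ffunE inordK// ltnS -[X in (_ <= X)%N]card_ord max_card.
Qed.

Lemma path_ofS (i : 'I_n) : path_of (lift ord0 i) =
  (path_of (widen_ord (leqnSn n) i) + fiber_size i)%N :> nat.
Proof.
rewrite !path_ofE /= /bump add1n -cardsUI [X in _ = (_ + X)%N]eq_card0 ?addn0.
  by apply: eq_card => k; rewrite !inE ltnS leq_eqVlt orbC.
by move=> k; rewrite !inE; apply/negbTE/negP => /andP[+ /eqP ki]; rewrite ki ltnn.
Qed.

(** At an index that is not a jump both sides are [0], which is why the equality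
    holds without restriction. *)
Lemma corresponds_incr S : is_spath S -> corresponds S p ->
  forall i, incr S i = fiber_size i.
Proof.
move=> /and4P[_ _ _ /forallP Smono] /and3P[_ /forallP Sj /forall_inP Sc] i.
have := Sj i; rewrite exists_is_top; have [ti|ti] := boolP (_ == i).
  move=> _; have ip : finset.pblock p i \in p by rewrite pblock_mem// covp inE.
  have /forallP/(_ i) := Sc _ ip; rewrite is_topE// eqxx ti/= => /eqP <-.
  by rewrite fiber_size_top//; exact/eqP.
rewrite (fiber_size_eq0 ti) /jump /incr => /eqP/negbT; rewrite -leqNgt => Si.
by apply/eqP; rewrite subn_eq0.
Qed.

Lemma is_spath_path_of : is_spath path_of.
Proof.
apply/and4P; split.
- by rewrite -val_eqE /= path_ofE cards_eq0; apply/eqP/setP => k; rewrite !inE.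
- rewrite -val_eqE /= path_ofE; apply/eqP; rewrite -[RHS]card_ord.
  by apply: eq_card => k; rewrite !inE ltn_ord.
- apply/forallP => j; rewrite path_ofE.
  have jn : (j <= n)%N by rewrite -ltnS.
  rewrite -[X in (_ <= X)%N](card_ord j).
  have winj : injective (widen_ord jn).
    by move=> k l /(congr1 val) /= kl; exact: val_inj.
  rewrite -(card_imset _ winj).
  apply/subset_leq_card/fintype.subsetP => k; rewrite inE => kj.
  have kj' : (k < j)%N by apply: leq_ltn_trans kj; exact: leq_top_of_cell.
  by apply/imsetP; exists (Ordinal kj') => //; exact: val_inj.
- by apply/forallP => i; rewrite path_ofS leq_addr.
Qed.

Lemma corresponds_path_of : corresponds path_of p.
Proof.
have incrE i : incr path_of i = fiber_size i.
  by rewrite /incr path_ofS addKn.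
rewrite /corresponds partp /=; apply/andP; split.
  apply/forallP => i; rewrite exists_is_top /jump path_ofS -[X in (X < _)%N]addn0.
  rewrite ltn_add2l; have [ti|ti] := boolP (top_of_cell p i == i); last first.
    by rewrite fiber_size_eq0.
  by rewrite eqb_id card_gt0; apply/set0Pn; exists i; rewrite inE.
apply/forall_inP => C Cp; apply/forallP => i; apply/implyP.
rewrite is_topE// => /andP[/eqP -> /eqP ti].
by rewrite incrE fiber_size_top.
Qed.

Lemma corresponds_uniq S : is_spath S -> corresponds S p -> S = path_of.
Proof.
move=> Sspath Sp; have SE := corresponds_incr Sspath Sp.
have /and4P[/eqP S0 _ _ /forallP Smono] := Sspath.
have /and4P[/eqP p0 _ _ _] := is_spath_path_of.
apply/ffunP => -[j jn]; apply: val_inj.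
elim: j jn => [|j IH] jn.
  by rewrite (_ : Ordinal jn = ord0) ?S0 ?p0//; exact: val_inj.
have jn' : (j < n)%N by rewrite -ltnS.
have -> : Ordinal jn = lift ord0 (Ordinal jn') by exact: val_inj.
rewrite /= path_ofS -SE /incr.
have <- : val (S (widen_ord (leqnSn n) (Ordinal jn'))) =
    path_of (widen_ord (leqnSn n) (Ordinal jn')).
  rewrite (_ : widen_ord _ _ = Ordinal (ltnW jn)); last exact: val_inj.
  exact: IH.
by rewrite subnKC//; exact: Smono.
Qed.

End partition.

(** Every partition corresponds to exactly one S-path. *)
Lemma sum_partition_path (V : nmodType) (F : {set {set 'I_n}} -> V) :
  (\sum_(p : {set {set 'I_n}} | finset.partition p [set: 'I_n]%SET) F p =
   \sum_(S : {ffun 'I_n.+1 -> 'I_n.+1} | is_spath S)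
     \sum_(p in path_partitions S) F p)%R.
Proof.
rewrite (partition_big path_of (@is_spath n))/=; last exact: is_spath_path_of.
apply: eq_bigr => S Sspath; apply: eq_bigl => p; rewrite inE.
apply/andP/idP => [[partp /eqP <-]|Sp]; first exact: corresponds_path_of.
have /and3P[partp _ _] := Sp; split => //.
by rewrite -(corresponds_uniq partp Sspath Sp).
Qed.

Lemma path_partitionsP S p : is_spath S -> p \in path_partitions S ->
  [/\ finset.partition p [set: 'I_n]%SET,
      forall i, #|[set k | top_of_cell p k == i]%SET| = incr S i &
      forall i, (i \in jumps S) = (top_of_cell p i == i)].
Proof.
move=> Sspath; rewrite inE => Sp; have /and3P[partp /forallP Sj _] := Sp.
split => // i; first exact/esym/(corresponds_incr partp).
rewrite mem_filter mem_enum andbT.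
by have /eqP -> := Sj i; rewrite exists_is_top.
Qed.

End tops.

Lemma ker_partition_fibers (I : finType) (J : eqType) (l : I -> J) (s : seq J) :
  uniq s -> s =i codom l ->
  perm_eq (enum (ker_partition l))
    [seq [set i | l i == c]%SET | c <- s].
Proof.
move=> us sl; apply: uniq_perm; first exact: enum_uniq.
  rewrite map_inj_in_uniq// => c c'; rewrite !sl => /codomP[i ->] _.
  by move=> /setP/(_ i); rewrite !inE eqxx => /esym/eqP.
move=> C; rewrite mem_enum; apply/imsetP/mapP => [[i _ ->]|[c]].
  exists (l i); first by rewrite sl codom_f.
  by apply/setP => j; rewrite !inE eq_sym.
rewrite sl => /codomP[i ->] ->; exists i => //.
by apply/setP => j; rewrite !inE eq_sym.
Qed.

Lemma cell_sizes_fibers (I : finType) (J : eqType) (l : I -> J) (s : seq J) :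
  uniq s -> s =i codom l ->
  perm_eq (cell_sizes (ker_partition l))
    [seq #|[set i | l i == c]%SET| | c <- s].
Proof.
move=> us sl.
rewrite (map_comp (fun C : {set I} => #|C|) (fun c => [set i | l i == c]%SET)).
exact/perm_map/ker_partition_fibers.
Qed.

(** Two labellings with equally many points of each label are rearrangements of
    the same list of labels. *)
Lemma same_fibers_perm N (J : finType) (l l' : 'I_N -> J) :
  (forall c, #|[set i | l i == c]%SET| = #|[set i | l' i == c]%SET|) ->
  exists s : {perm 'I_N}, forall i, l i = l' (s i).
Proof.
move=> ll'.
have /tuple_permP[s sE] : perm_eq [tuple l i | i < N] [tuple l' i | i < N].
  apply/allP => c _ /=; rewrite !count_map.
  have cE (h : 'I_N -> J) :
      count (preim id (preim [eta h] (pred1 c))) (Finite.enum 'I_N) =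
      #|[set i | h i == c]%SET|.
    by rewrite cardE /enum_mem size_filter; apply: eq_count => i /=; rewrite inE.
  by rewrite !cE ll'.
exists s => i.
have := congr1 (fun x => nth (l i) x i) sE.
by rewrite !nth_mktuple tnth_mktuple.
Qed.

(** * The complete likelihood and the ordered data *)
Lemma eq_ker_partition (I : finType) (T T' : eqType) (x : I -> T)
    (y : I -> T') : ker_partition x = ker_partition y <->
  forall i j, (x i == x j) = (y i == y j).
Proof.
split => [xy i j|xy].
  by rewrite -(pblock_ker_partition x) xy pblock_ker_partition.
apply/(ker_partitionP _ (preim_partitionP y [set: I]%SET)) => i j.
by rewrite -/(ker_partition y) pblock_ker_partition.
Qed.

Lemma inv_power_out (R : realType) (D : interval R) e x :
  x \notin D -> inv_power D e x = 0.
Proof. by move=> xD; rewrite /inv_power indicE mem_setE (negbTE xD) mul0r. Qed.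

Lemma inv_power_in (R : realType) (D : interval R) e x :
  x \in D -> inv_power D e x = (`|x| ^- e)%:E.
Proof. by move=> xD; rewrite /inv_power indicE mem_setE xD mul1r. Qed.

Section data.
Context (R : realType) (theta : R) (N : nat) (t : N.-tuple R).
Hypotheses (tuniq : uniq t) (thetat : theta \notin t).

Local Notation Ys := (Ys theta t).
Local Notation Zs := (Zs theta t).
Local Notation n := (size Ys).
Local Notation m := (size Zs).

(** An observation is indexed by its rank among the negative ([inl]) or the
    positive ([inr]) ones; this avoids any cast between [N] and the sum of the
    two sizes. *)
Definition datum (c : 'I_m + 'I_n) : R :=
  match c with inl j => Zs`_j | inr j => Ys`_j end%R.

Lemma mem_Ys y : (y \in Ys) = (0 < y)%R && ((y + theta)%R \in (t : seq R)).
Proof.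
rewrite mem_sort; apply/mapP/andP => [[s]|[y0 yt]].
  by rewrite mem_filter => /andP[s0 st] ->; rewrite subrK.
by exists (y + theta)%R; rewrite ?addrK// mem_filter addrK y0.
Qed.

Lemma mem_Zs y : (y \in Zs) = (y < 0)%R && ((y + theta)%R \in (t : seq R)).
Proof.
rewrite mem_sort; apply/mapP/andP => [[s]|[y0 yt]].
  by rewrite mem_filter => /andP[s0 st] ->; rewrite subrK.
by exists (y + theta)%R; rewrite ?addrK// mem_filter addrK y0.
Qed.

Lemma Ys_uniq : uniq Ys.
Proof.
by rewrite sort_uniq map_inj_uniq ?filter_uniq// => x y /addIr.
Qed.

Lemma Zs_uniq : uniq Zs.
Proof.
by rewrite sort_uniq map_inj_uniq ?filter_uniq// => x y /addIr.
Qed.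

Lemma Ys_gt0 (j : 'I_n) : (0 < Ys`_j)%R.
Proof. by have := mem_nth 0%R (ltn_ord j); rewrite mem_Ys => /andP[]. Qed.

Lemma Zs_lt0 (j : 'I_m) : (Zs`_j < 0)%R.
Proof. by have := mem_nth 0%R (ltn_ord j); rewrite mem_Zs => /andP[]. Qed.

Lemma Ys_mono (j k : 'I_n) : (j <= k)%N -> (Ys`_j <= Ys`_k)%R.
Proof.
move=> jk; apply: (sorted_leq_nth le_trans le_refl); rewrite ?inE//.
by apply: sort_sorted; exact: le_total.
Qed.

Lemma Zs_mono (j k : 'I_m) : (j <= k)%N -> (Zs`_k <= Zs`_j)%R.
Proof.
move=> jk.
apply: (@sorted_leq_nth _ (fun x y : R => (y <= x)%R)); rewrite ?inE//.
- by move=> x y z yx zx; exact: le_trans yx.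
- by apply: sort_sorted => x y; exact: le_total.
Qed.

Lemma datum_inj : injective datum.
Proof.
move=> [j|j] [k|k] /=.
- move=> /eqP; rewrite nth_uniq ?Zs_uniq// => /eqP jk.
  by congr inl; exact: val_inj.
- by move=> jk; have := Ys_gt0 k; rewrite -jk ltNge ltW// Zs_lt0.
- by move=> jk; have := Ys_gt0 j; rewrite jk ltNge ltW// Zs_lt0.
- move=> /eqP; rewrite nth_uniq ?Ys_uniq// => /eqP jk.
  by congr inr; exact: val_inj.
Qed.

Lemma rank_of_data : {rk : 'I_N -> 'I_m + 'I_n |
  bijective rk & forall i, (tnth t i - theta = datum (rk i))%R}.
Proof.
have rkP i : exists c, (tnth t i - theta == datum c)%R.
  have : (tnth t i - theta)%R != 0%R.
    by rewrite subr_eq0; apply: contraNneq thetat => <-; exact: mem_tnth.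
  rewrite neq_lt => /orP[s0|s0].
    have sZ : (tnth t i - theta)%R \in Zs by rewrite mem_Zs s0 subrK mem_tnth.
    have lt : (index (tnth t i - theta)%R Zs < m)%N by rewrite index_mem.
    by exists (inl (Ordinal lt)); rewrite /= nth_index.
  have sY : (tnth t i - theta)%R \in Ys by rewrite mem_Ys s0 subrK mem_tnth.
  have lt : (index (tnth t i - theta)%R Ys < n)%N by rewrite index_mem.
  by exists (inr (Ordinal lt)); rewrite /= nth_index.
pose rk i := xchoose (rkP i).
have rkE i : (tnth t i - theta = datum (rk i))%R by apply/eqP/(xchooseP (rkP i)).
have preim c : exists i, (tnth t i - theta == datum c)%R.
  have : (datum c + theta)%R \in (t : seq R).
    by case: c => j /=; have := mem_nth 0%R (ltn_ord j);
      rewrite ?mem_Ys ?mem_Zs => /andP[].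
  by move=> /tnthP[i ti]; exists i; rewrite -ti addrK.
exists rk => //; exists (fun c => xchoose (preim c)) => [i|c].
  have := xchooseP (preim (rk i)); move: (xchoose _) => i' /eqP.
  by rewrite -rkE => /addIr; move/tuple_uniqP : tuniq; apply.
by apply: datum_inj; rewrite -rkE; apply/eqP/(xchooseP (preim c)).
Qed.

(** The latent values that can have produced the observation of rank [c]. *)
Definition admissible (c : 'I_m + 'I_n) : interval R :=
  match c with inl j => `]-oo, Zs`_j] | inr j => `[Ys`_j, +oo[ end%R.

Lemma kern_admissible s c x : (s - theta = datum c)%R ->
  (kern theta x s)%:E = inv_power (admissible c) 1 x.
Proof.
rewrite /kern /inv_power indicE expr1 mem_setE => ->.
case: c => j /=; congr EFin; rewrite in_itv/= ?andbT.
  have Z0 := Zs_lt0 j; rewrite (ltNge _ _%R) (ltW Z0)/= sub0r Z0 andbT mulrC.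
  case: (leP x _) => xZ; rewrite ?oppr0 ?mul0r// mulN1r mul1r.
  by rewrite ltr0_norm ?invrN// (le_lt_trans xZ).
have Y0 := Ys_gt0 j; rewrite Y0/= (ltNge _ 0%R) (ltW Y0)/= andbF subr0 mulrC.
case: (leP _ x) => xY; rewrite ?mul0r// !mul1r.
by rewrite gtr0_norm// (lt_le_trans Y0).
Qed.

(** The rank of the most extreme observation in the cell of [c]. *)
Definition cell_top (pm : {set {set 'I_m}}) (pp : {set {set 'I_n}})
    (c : 'I_m + 'I_n) : 'I_m + 'I_n :=
  match c with
  | inl j => inl (top_of_cell pm j)
  | inr j => inr (top_of_cell pp j)
  end.

Variable rk : 'I_N -> 'I_m + 'I_n.
Hypotheses (rk_bij : bijective rk)
  (rkE : forall i, (tnth t i - theta = datum (rk i))%R).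

Lemma tnth_sample_of (Sm : neg_path theta t) (Sp : pos_path theta t) pm pp
    (v u : seq R) i :
  tnth (sample_of Sm Sp pm pp v u) i =
  match cell_top pm pp (rk i) with
  | inl j => at_jump Sm v j
  | inr j => at_jump Sp u j
  end.
Proof.
rewrite tnth_map rkE; case: (rk i) => j /=; last first.
  rewrite index_uniq ?Ys_uniq// (insubT (fun k => (k < n)%N) (ltn_ord j))/=.
  by congr (at_jump _ _ (top_of_cell _ _)); exact: val_inj.
rewrite insubN; last first.
  rewrite index_mem mem_Ys negb_and -leNgt ltW ?Zs_lt0//.
rewrite index_uniq ?Zs_uniq// (insubT (fun k => (k < m)%N) (ltn_ord j))/=.
by congr (at_jump _ _ (top_of_cell _ _)); exact: val_inj.
Qed.

Lemma complete_likelihoodE x : complete_likelihood theta t x =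
  \prod_(i < N) inv_power (admissible (rk i)) 1 (tnth x i).
Proof.
rewrite /complete_likelihood -prodEFin; apply: eq_bigr => i _.
exact: kern_admissible.
Qed.

Section two_partitions.
Variables (pm : {set {set 'I_m}}) (pp : {set {set 'I_n}}).
Hypotheses (partm : finset.partition pm [set: 'I_m]%SET)
  (partp : finset.partition pp [set: 'I_n]%SET).

Local Notation top := (cell_top pm pp).

Lemma cell_topK c : top (top c) = top c.
Proof. by case: c => j /=; rewrite top_of_cellK. Qed.

Lemma admissible_cell_top c x : x \in admissible (top c) -> x \in admissible c.
Proof.
case: c => j /=; rewrite !in_itv/= ?andbT => h.
  by apply: (le_trans h); apply: Zs_mono; exact: leq_top_of_cell.
by apply: le_trans h; apply: Ys_mono; exact: leq_top_of_cell.
Qed.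

(** Observations of one cell share their latent value, and the most extreme of
    them is the most constraining: the others may be given its constraint.
    Conversely its constraint cannot fail on the right without failing on the
    left, as it occurs there too. *)
Lemma prod_inv_power_cell_top (x : 'I_N -> R) :
  ker_partition x = ker_partition (top \o rk) ->
  \prod_(i < N) inv_power (admissible (rk i)) 1 (x i) =
  \prod_(i < N) inv_power (admissible (top (rk i))) 1 (x i).
Proof.
move=> /eq_ker_partition xtop.
have [xin|/existsNP[i /negP xi]] :=
    pselect (forall i, x i \in admissible (top (rk i))).
  apply: eq_bigr => i _; rewrite /inv_power !indicE !mem_setE.
  by rewrite xin admissible_cell_top.
have [rki rkK rkiK] := rk_bij.
rewrite [RHS](bigD1 i)//= inv_power_out// mul0e.
have xii : x (rki (top (rk i))) = x i.
  by apply/eqP; rewrite xtop /= rkiK cell_topK.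
by rewrite (bigD1 (rki (top (rk i))))//= xii rkiK inv_power_out// mul0e.
Qed.

(** When the likelihood does not vanish, the sign of a latent value is that of
    the observation, so that no tie joins the two groups. *)
Lemma ker_cell_topP (x : N.-tuple R) : complete_likelihood theta t x != 0 ->
  ker_partition (tnth x) = ker_partition (top \o rk) <->
  exists2 rki, cancel rki rk &
  ker_partition (fun j => tnth x (rki (inl j))) = pm /\
  ker_partition (fun j => tnth x (rki (inr j))) = pp.
Proof.
rewrite complete_likelihoodE => L0.
have xin i : tnth x i \in admissible (rk i).
  by apply: contraNT L0 => xi; rewrite (bigD1 i)//= inv_power_out// mul0e.
have [rki rkK rkiK] := rk_bij.
split => [/eq_ker_partition xtop|[rki' rkiK' [xm xp]]].
  exists rki => //; split.
    apply/(ker_partitionP _ partm) => i j.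
    by rewrite xtop /= !rkiK /= (inj_eq inl_inj) eq_top_of_cell.
  apply/(ker_partitionP _ partp) => i j.
  by rewrite xtop /= !rkiK /= (inj_eq inr_inj) eq_top_of_cell.
have rkiE : rki' = rki.
  by apply/funext => c; apply: (can_inj rkK); rewrite rkiK rkiK'.
rewrite {}rkiE {rkiK'} in xm xp; apply/eq_ker_partition => i j.
rewrite -(rkK i) -(rkK j) /= !rkiK; move: (rk i) (rk j) => ci cj.
have := xin (rki ci); have := xin (rki cj); rewrite !rkiK.
move: xm xp => /(ker_partitionP _ partm) xm /(ker_partitionP _ partp) xp.
case: ci => i'; case: cj => j' /=; rewrite !in_itv/= ?andbT => xj xi.
- by rewrite xm -eq_top_of_cell// (inj_eq inl_inj).
- apply/eqP => xij; have := le_lt_trans xi (Zs_lt0 i').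
  by rewrite xij ltNge (le_trans (ltW (Ys_gt0 j')) xj).
- apply/eqP => xij; have := le_lt_trans xj (Zs_lt0 j').
  by rewrite -xij ltNge (le_trans (ltW (Ys_gt0 i')) xi).
- by rewrite xp -eq_top_of_cell// (inj_eq inr_inj).
Qed.

End two_partitions.

(** Exactly one pair of partitions gives the ties of [x], unless the likelihood
    vanishes. *)
Lemma complete_likelihood_split (x : N.-tuple R) :
  complete_likelihood theta t x =
  \sum_(pp : {set {set 'I_n}} | finset.partition pp [set: 'I_n]%SET)
    \sum_(pm : {set {set 'I_m}} | finset.partition pm [set: 'I_m]%SET)
      (ker_partition (tnth x) == ker_partition (cell_top pm pp \o rk))%:R%:E *
      complete_likelihood theta t x.
Proof.
have [->|L0] := eqVneq (complete_likelihood theta t x) 0.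
  by rewrite big1// => pp _; rewrite big1// => pm _; rewrite mule0.
have [rki rkK rkiK] := rk_bij.
pose xm := ker_partition (fun j => tnth x (rki (inl j))).
pose xp := ker_partition (fun j => tnth x (rki (inr j))).
have partm : finset.partition xm [set: 'I_m]%SET by exact: preim_partitionP.
have partp : finset.partition xp [set: 'I_n]%SET by exact: preim_partitionP.
have kerP pm pp : finset.partition pm [set: 'I_m]%SET ->
    finset.partition pp [set: 'I_n]%SET ->
    (ker_partition (tnth x) == ker_partition (cell_top pm pp \o rk)) =
    (xm == pm) && (xp == pp).
  move=> hm hp; apply/eqP/andP => [/(ker_cell_topP hm hp L0)|[/eqP hxm /eqP hxp]].
    move=> [rki' rkiK' []].
    have -> : rki' = rki.
      by apply/funext => c; apply: (can_inj rkK); rewrite rkiK rkiK'.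
    by move=> <- <-.
  by apply/(ker_cell_topP hm hp L0); exists rki.
rewrite (bigD1 xp)//= (bigD1 xm)//= kerP// !eqxx/= mul1e.
rewrite [X in _ + X + _]big1 ?adde0; last first.
  by move=> pm /andP[hm hmx]; rewrite kerP// (eq_sym xm) (negbTE hmx) mul0e.
rewrite [X in _ + X]big1 ?adde0// => pp /andP[hp hpx]; rewrite big1// => pm hm.
by rewrite kerP// (eq_sym xp) (negbTE hpx) andbF mul0e.
Qed.

Section path_fibers.
Variables (Sm : neg_path theta t) (Sp : pos_path theta t)
  (pm : {set {set 'I_m}}) (pp : {set {set 'I_n}}).
Hypotheses (hSm : is_spath Sm) (hSp : is_spath Sp)
  (hpm : pm \in path_partitions Sm) (hpp : pp \in path_partitions Sp).

Local Notation top := (cell_top pm pp).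

(** The most extreme observations of the cells, which label the unique values.
    The order, positive jumps first, is that of the arguments of [chi] in
    [phi_neg]. *)
Definition all_jumps : seq ('I_m + 'I_n) :=
  [seq inr j | j <- jumps Sp] ++ [seq inl j | j <- jumps Sm].

Definition all_incr (c : 'I_m + 'I_n) : nat :=
  match c with inl j => incr Sm j | inr j => incr Sp j end.

Lemma all_jumps_uniq : uniq all_jumps.
Proof.
have ju k (S : {ffun 'I_k.+1 -> 'I_k.+1}) : uniq (jumps S).
  by rewrite filter_uniq// enum_uniq.
rewrite cat_uniq (map_inj_uniq inl_inj) (map_inj_uniq inr_inj) !ju andbT /=.
apply/hasPn => c /mapP[j _ ->].
by apply/mapP => -[].
Qed.

Lemma mem_all_jumps : all_jumps =i codom (top \o rk).
Proof.
have [partm fm jm] := path_partitionsP hSm hpm.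
have [partp fp jp] := path_partitionsP hSp hpp.
have [rki rkK rkiK] := rk_bij.
have codomE c : (c \in codom (top \o rk)) = (top c == c).
  apply/codomP/eqP => [[i ->]|<-]; first by rewrite /= cell_topK.
  by exists (rki c); rewrite /= rkiK.
move=> c; rewrite codomE mem_cat; case: c => j /=.
  rewrite (inj_eq inl_inj) -jm (mem_map inl_inj).
  by rewrite (_ : _ \in _ = false)//; apply/mapP => -[].
rewrite (inj_eq inr_inj) -jp (mem_map inr_inj) orbC.
by rewrite (_ : _ \in _ = false)//; apply/mapP => -[].
Qed.

Lemma card_cell_top c : #|[set i | top (rk i) == c]%SET| = all_incr c.
Proof.
have [partm fm jm] := path_partitionsP hSm hpm.
have [partp fp jp] := path_partitionsP hSp hpp.
have cardE (D : {set 'I_m + 'I_n}) : #|[set i | rk i \in D]%SET| = #|D|.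
  rewrite -(on_card_preimset (f := rk)); last exact: onW_bij.
  by apply: eq_card => i; rewrite !inE.
rewrite (_ : [set i | top (rk i) == c]%SET =
  [set i | rk i \in [set c' | top c' == c]]%SET); last first.
  by apply/setP => i; rewrite !inE.
rewrite cardE; case: c => j /=.
  rewrite -fm -(card_imset _ (@inl_inj 'I_m 'I_n)); apply: eq_card => -[k|k].
    by rewrite (mem_imset _ _ inl_inj) !inE /= (inj_eq inl_inj).
  by rewrite inE /=; apply/esym/imsetP => -[].
rewrite -fp -(card_imset _ (@inr_inj 'I_m 'I_n)); apply: eq_card => -[k|k].
  by rewrite inE /=; apply/esym/imsetP => -[].
by rewrite (mem_imset _ _ inr_inj) !inE /= (inj_eq inr_inj).
Qed.

Lemma cell_sizes_cell_top :
  perm_eq (cell_sizes (ker_partition (top \o rk)))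
    (jump_sizes Sp ++ jump_sizes Sm).
Proof.
have -> : jump_sizes Sp ++ jump_sizes Sm =
    [seq #|[set i | (top \o rk) i == c]%SET| | c <- all_jumps].
  rewrite map_cat -!map_comp; congr (_ ++ _); apply: eq_map => j /=;
    by rewrite card_cell_top.
exact: cell_sizes_fibers all_jumps_uniq mem_all_jumps.
Qed.

End path_fibers.

End data.

Lemma cell_sizes_path n (S : {ffun 'I_n.+1 -> 'I_n.+1}) (p : {set {set 'I_n}}) :
  is_spath S -> p \in path_partitions S ->
  perm_eq (cell_sizes p) (jump_sizes S).
Proof.
move=> hS hp; have [partp fS jS] := path_partitionsP hS hp.
have -> : jump_sizes S =
    [seq #|[set i | top_of_cell p i == c]%SET| | c <- jumps S].
  by apply: eq_map => j /=; rewrite fS.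
rewrite -{1}(ker_top_of_cell partp); apply: cell_sizes_fibers.
  by rewrite filter_uniq// enum_uniq.
move=> j; rewrite jS; apply/eqP/codomP => [<-|[i ->]].
  by exists (top_of_cell p j); rewrite top_of_cellK.
exact: top_of_cellK.
Qed.

(** * The contribution of a pair of paths *)
Lemma prod_inv_power (R : realType) (I : finType) (D : interval R)
    (A : {set I}) (x : R) : A != finset.set0 ->
  \prod_(i in A) inv_power D 1 x = inv_power D #|A| x.
Proof.
move=> /set0Pn[i iA]; have [xD|xD] := boolP (x \in D); last first.
  by rewrite (bigD1 i)//= !inv_power_out// mul0e.
rewrite !inv_power_in//.
by rewrite prodEFin prodr_const expr1 exprVn.
Qed.

Lemma tuple_prod_rectangle (R : realType) (I : eqType) (s : seq I)
    (mu : I -> probability R R) (B : I -> set R) :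
  uniq s -> (forall i, measurable (B i)) ->
  tuple_prod [seq mu i | i <- s]
    [set u : (size [seq mu i | i <- s]).-tuple R |
      forall i, i \in s -> B i (nth 0%R u (index i s))] =
  \prod_(i <- s) mu i (B i).
Proof.
case: s => [_ mB|i0 s us mB].
  rewrite big_nil (_ : [set u | _] = setT) ?probability_setT//.
  by apply/seteqP; split.
set s' := i0 :: s in us *; set mus := [seq mu i | i <- s'].
have szE : size mus = size s' by rewrite size_map.
set E := [set u | _].
have EE : E = [set u : (size mus).-tuple R |
    forall k : 'I_(size mus), B (nth i0 s' k) (tnth u k)].
  apply/seteqP; split => [u uB k|u uB i si].
    have ks : (k < size s')%N by rewrite -szE.
    have := uB (nth i0 s' k) (mem_nth i0 ks).
    by rewrite index_uniq// (tnth_nth 0%R).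
  have ks : (index i s' < size mus)%N by rewrite szE index_mem.
  have := uB (Ordinal ks); rewrite (tnth_nth 0%R) /= -/s' nth_index//.
have mE : measurable E.
  rewrite EE.
  exact: (@measurable_rectangle _ _ _ (fun k : 'I_(size mus) => B (nth i0 s' k))).
rewrite -(setIT E) -integral_indic//.
transitivity (\int[tuple_prod mus]_u \prod_(k < size mus)
    (\1_(B (nth i0 s' k)) (tnth u k))%:E).
  apply: eq_integral => u _.
  rewrite (prod_indic R (fun k : 'I_(size mus) => B (nth i0 s' k)) (tnth u)).
  rewrite indicE EE; congr ((nat_of_bool _)%:R%:E).
rewrite (@ge0_integral_tuple_prod _ _ _ (mu i0) mus
  (fun k x => (\1_(B (nth i0 s' k)) x)%:E))//; last first.
  by move=> k; apply/measurable_EFinP; exact: measurable_indic.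
rewrite -(big_mkord xpredT (fun k => \int[nth (mu i0) mus k]_x
  (\1_(B (nth i0 s' k)) x)%:E)) szE (big_nth i0) big_nat [RHS]big_nat.
apply: eq_bigr => k /andP[_ ks].
by rewrite integral_indic// setIT (nth_map i0).
Qed.

Lemma measurable_ker_indicator (R : realType) N (T : eqType) (l : 'I_N -> T) :
  measurable_fun [set: N.-tuple R] (fun x =>
    (ker_partition (tnth x) == ker_partition l)%:R%:E : \bar R).
Proof.
have mK := @measurable_ker_partition R _ _ (preim_partitionP l [set: 'I_N]%SET).
apply/measurable_EFinP.
rewrite [X in measurable_fun _ X](_ : _ = \1_[set x : N.-tuple R |
    ker_partition (tnth x) = ker_partition l]); first exact: measurable_indic.
apply/funext => x; rewrite indicE; congr ((nat_of_bool _)%:R)%R.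
by apply/eqP/idP => [?|/set_mem//]; exact/mem_set.
Qed.

Lemma sume_const (R : realType) (I : finType) (A : {set I}) (x : \bar R) :
  0 <= x -> \sum_(i in A) x = #|A|%:R%:E * x.
Proof.
move=> x0; rewrite big_const; elim: #|A| => [|k IH]; first by rewrite mul0e.
by rewrite iterS IH -addn1 natrD EFinD ge0_muleDl ?lee_fin// mul1e addeC.
Qed.

Lemma ge0_integral_sum_cond d (T : measurableType d) (R : realType)
    (mu : {measure set T -> \bar R}) (D : set T) (I : Type) (s : seq I)
    (Q : pred I) (f : I -> T -> \bar R) :
  measurable D -> (forall i, measurable_fun D (f i)) ->
  (forall i x, D x -> 0 <= f i x) ->
  \int[mu]_(x in D) (\sum_(i <- s | Q i) f i x) =
  \sum_(i <- s | Q i) \int[mu]_(x in D) f i x.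
Proof.
move=> mD mf f0; rewrite -[RHS]big_filter -ge0_integral_sum//.
by apply: eq_integral => x _; rewrite big_filter.
Qed.

(** A null weight kills the term whatever [a], [b] and [c] are; elsewhere the
    finiteness of the two sums makes [a] and [b] finite. *)
Lemma sum_weighted_diff (R : realType) (I : Type) (s : seq I) (Q : pred I)
    (w : I -> R) (a b c : I -> \bar R) :
  (forall i, Q i -> (0 <= w i)%R) ->
  (forall i, Q i -> 0 <= a i) -> (forall i, Q i -> 0 <= b i) ->
  \sum_(i <- s | Q i) a i * (w i)%:E \is a fin_num ->
  \sum_(i <- s | Q i) b i * (w i)%:E \is a fin_num ->
  (forall i, Q i -> a i \is a fin_num -> b i \is a fin_num ->
    c i = a i - b i) ->
  \sum_(i <- s | Q i) a i * (w i)%:E - \sum_(i <- s | Q i) b i * (w i)%:E =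
  \sum_(i <- s | Q i) c i * (w i)%:E.
Proof.
move=> w0 a0 b0; elim: s => [|i s IH]; first by rewrite !big_nil sube0.
rewrite !big_cons; case: ifPn => // Qi; rewrite !fin_numD.
move=> /andP[afin asfin] /andP[bfin bsfin] cE; rewrite -IH//.
rewrite oppeD ?fin_num_adde_defr// addeACA; congr (_ + _).
have [wi0|wi0] := eqVneq (w i) 0%R; first by rewrite wi0 !mule0 sube0.
have wi : (0 < w i)%R by rewrite lt_neqAle eq_sym wi0 w0.
have fin x : 0 <= x -> x * (w i)%:E \is a fin_num -> x \is a fin_num.
  by case: x => [x|_|//] //; rewrite gt0_mulye ?lte_fin.
have {}afin := fin _ (a0 _ Qi) afin; have {}bfin := fin _ (b0 _ Qi) bfin.
by rewrite cE// muleBl// fin_num_adde_defr.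
Qed.

Lemma integral_kernel_funeposneg d d' (X : measurableType d)
    (Y : measurableType d') (R : realType) (mu : {measure set X -> \bar R})
    (k : X -> {measure set Y -> \bar R}) (g : Y -> \bar R) :
  (forall B, measurable B -> measurable_fun [set: X] (k ^~ B)) ->
  measurable_fun [set: Y] g ->
  \int[mu]_x \int[k x]_y g^\+ y \is a fin_num ->
  \int[mu]_x \int[k x]_y g^\- y \is a fin_num ->
  \int[mu]_x \int[k x]_y g y =
  \int[mu]_x \int[k x]_y g^\+ y - \int[mu]_x \int[k x]_y g^\- y.
Proof.
move=> mk mg pfin nfin.
have ig h : (forall y, 0 <= h y) -> measurable_fun [set: Y] h ->
    \int[mu]_x \int[k x]_y h y \is a fin_num ->
    mu.-integrable [set: X] (fun x => \int[k x]_y h y).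
  move=> h0 mh hfin; apply/integrableP; split.
    exact: measurable_fun_integral_kernel.
  under eq_integral do rewrite gee0_abs ?integral_ge0//.
  by rewrite -ge0_fin_numE//; do 2 (apply: integral_ge0 => ? _).
rewrite -integralB//.
- by apply: eq_integral => x _; rewrite integralE.
- by apply: ig => //; exact: measurable_funepos.
- by apply: ig => //; exact: measurable_funeneg.
Qed.

Section path_term.
Context d (Omega : measurableType d) (R : realType).
Variables (P : probability Omega R) (H : probability R R)
  (G : {RV P >-> pprobability R R}) (chi : seq nat -> R).
Hypotheses (H0 : nonatomic H) (Gchi : is_eppf H G chi).
Variables (theta : R) (N : nat) (X T : 'I_N -> {RV P >-> R}) (t : N.-tuple R).
Hypotheses (model : mixture_model G theta X T)
  (tuniq : uniq t) (thetat : theta \notin t).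

Local Notation n := (size (Ys theta t)).
Local Notation m := (size (Zs theta t)).

Variable rk : 'I_N -> 'I_m + 'I_n.
Hypotheses (rk_bij : bijective rk)
  (rkE : forall i, (tnth t i - theta = datum (rk i))%R).

Let sampledX : sampled_from G X.
Proof. exact: (sampled_from_sub H0 Gchi model (@inj_id _)). Qed.

Lemma inv_power_admissible_le (c : 'I_m + 'I_n) e x :
  inv_power (admissible c) e x <= (`|datum c| ^- e)%:E.
Proof.
have [xc|xc] := boolP (x \in admissible c); last first.
  by rewrite inv_power_out// lee_fin invr_ge0 exprn_ge0.
have c0 : (0 < `|datum c|)%R.
  by rewrite normr_gt0; case: (c) => j /=;
    [rewrite lt_eqF ?Zs_lt0|rewrite gt_eqF ?Ys_gt0].
have cx : (`|datum c| <= `|x|)%R.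
  move: xc; case: (c) => j /=; rewrite in_itv/= ?andbT => xc.
    by rewrite !ler0_norm ?lerN2// ?(le_trans xc)// ltW ?Zs_lt0.
  by rewrite !ger0_norm// ?(le_trans _ xc)// ltW ?Ys_gt0.
rewrite inv_power_in// lee_fin lef_pV2 ?posrE ?exprn_gt0//.
  exact: lerXn2r.
exact: lt_le_trans cx.
Qed.

Lemma integral_inv_power_lty (c : 'I_m + 'I_n) e :
  \int[H]_x inv_power (admissible c) e x < +oo.
Proof.
apply: (@le_lt_trans _ _ (\int[H]_x cst (`|datum c| ^- e)%:E x)).
  apply: ge0_le_integral => //.
  - by move=> x _; exact: inv_power_ge0.
  - exact: measurable_inv_power.
  - by move=> x _; exact: inv_power_admissible_le.
rewrite integral_cst// [X in _ * X](_ : _ = 1) ?mule1 ?ltry//.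
exact: probability_setT.
Qed.

Section fixed_paths.
Variables (Sm : neg_path theta t) (Sp : pos_path theta t)
  (pm : {set {set 'I_m}}) (pp : {set {set 'I_n}}).
Hypotheses (hSm : is_spath Sm) (hSp : is_spath Sp)
  (hpm : pm \in path_partitions Sm) (hpp : pp \in path_partitions Sp).

Local Notation top := (cell_top pm pp).
Local Notation js := (all_jumps Sm Sp).
Local Notation inc := (all_incr Sm Sp).

Definition value_law (c : 'I_m + 'I_n) : probability R R :=
  tilt H (inv_power_ge0 (admissible c) (inc c))
    (measurable_inv_power (admissible c) (inc c)).

Definition cell_weight (c : 'I_m + 'I_n) : \bar R :=
  \int[H]_x inv_power (admissible c) (inc c) x.

Lemma eppf_cell_top :
  chi (cell_sizes (ker_partition (top \o rk))) =
  chi (jump_sizes Sp ++ jump_sizes Sm).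
Proof.
have [_ _ chiperm _] := Gchi.
apply: chiperm; last exact: cell_sizes_cell_top.
have /and3P[_ _ p0] := preim_partitionP (top \o rk) [set: 'I_N]%SET.
apply/allP => _ /mapP[C + ->]; rewrite mem_enum => Cp.
by rewrite card_gt0; apply: contraNneq p0 => <-.
Qed.

(** The latent values of different cells are independent, so the integral is a
    product over the cells; in each the likelihood is a power of the common
    value, that is, the density of [value_law] up to [cell_weight]. *)
Lemma integral_path_rectangle (A : 'I_N -> set R) :
  (forall i, measurable (A i)) ->
  \int[P]_w ((ker_partition (tnth (sample_tuple X w)) ==
              ker_partition (top \o rk))%:R%:E *
     (\prod_(i < N) (\1_(A i) (tnth (sample_tuple X w) i))%:E *
      complete_likelihood theta t (sample_tuple X w))) =
  (chi (jump_sizes Sp ++ jump_sizes Sm))%:E *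
  \prod_(c <- js) (cell_weight c *
     value_law c (\bigcap_(i in [set i | top (rk i) = c]) A i)).
Proof.
move=> mA.
have [partm _ _] := path_partitionsP hSm hpm.
have [partp _ _] := path_partitionsP hSp hpp.
pose f i x := (\1_(A i) x)%:E * inv_power (admissible (top (rk i))) 1 x : \bar R.
have f0 i x : 0 <= f i x by rewrite mule_ge0 ?lee_fin// inv_power_ge0.
have mf i : measurable_fun [set: R] (f i).
  apply: emeasurable_funM; last exact: measurable_inv_power.
  by apply/measurable_EFinP; exact: measurable_indic.
transitivity (\int[P]_w ((ker_partition (tnth (sample_tuple X w)) ==
    ker_partition (top \o rk))%:R%:E *
    \prod_(i < N) f i (tnth (sample_tuple X w) i))).
  apply: eq_integral => w _; case: eqP => [kw|_]; rewrite ?mul0e// !mul1e.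
  rewrite (complete_likelihoodE rkE).
  by rewrite (prod_inv_power_cell_top rk_bij partm partp kw) big_split.
have partr := preim_partitionP (top \o rk) [set: 'I_N]%SET.
rewrite (ge0_integral_sample_ker H0 Gchi sampledX
  (F := fun x => \prod_(i < N) f i (tnth x i)) partr); last 2 first.
- by move=> x; exact: prode_ge0.
- apply: emeasurable_prod => i.
  by apply: (measurableT_comp (mf i)); exact: measurable_tnth.
rewrite -[in LHS]/(ker_partition _) eppf_cell_top; congr (_ * _).
rewrite ge0_integral_partition_law// -big_enum/=.
rewrite (perm_big _ (ker_partition_fibers (all_jumps_uniq Sm Sp)
  (mem_all_jumps rk_bij hSm hSp hpm hpp)))/= big_map.
rewrite big_seq [RHS]big_seq; apply: eq_bigr => c cjs.
rewrite [RHS]tiltE//; last 2 first.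
- exact: integral_inv_power_lty.
- exact: fin_bigcap_measurable.
rewrite [RHS]integral_indicM; apply: eq_integral => x _.
rewrite (eq_bigr (fun i =>
  (\1_(A i) x)%:E * inv_power (admissible c) 1 x)); last first.
  by move=> i; rewrite inE /f /= => /eqP ->.
rewrite big_split/= prod_inv_power; last first.
  have := cjs; rewrite (mem_all_jumps rk_bij hSm hSp hpm hpp).
  by move=> /codomP[i ->]; apply/set0Pn; exists i; rewrite inE.
rewrite (card_cell_top rk_bij hSm hSp hpm hpp); congr (_ * _).
rewrite indicE; case: (boolP (_ \in _)) => [/set_mem xA|xA].
  rewrite big1// => i; rewrite inE => /eqP ic.
  by rewrite indicE mem_set//; exact: xA.
have /existsNP[i /not_implyP[/= iC xAi]] :
    ~ (\bigcap_(i in [set i | top (rk i) = c]) A i) x.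
  by move=> /mem_set; exact/negP.
by rewrite (bigD1 i)/= ?inE ?iC// indicE memNset// mul0e.
Qed.

Local Notation VU := ((size [seq H_neg H Sm i | i <- jumps Sm]).-tuple R *
  (size [seq H_pos H Sp i | i <- jumps Sp]).-tuple R)%type.

Definition sample_of_values (vu : VU) : N.-tuple R :=
  sample_of Sm Sp pm pp vu.1 vu.2.

Lemma measurable_sample_of_values : measurable_fun [set: VU] sample_of_values.
Proof.
apply/measurable_fun_tnthP => i.
apply: (eq_measurable_fun (fun vu : VU =>
    match top (rk i) with
    | inl j => at_jump Sm vu.1 j
    | inr j => at_jump Sp vu.2 j
    end)).
  by move=> vu _; rewrite /= (tnth_sample_of tuniq rkE).
case: (top (rk i)) => j; rewrite /at_jump.
  apply: (@measurableT_comp _ _ _ _ _ _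
    (fun v : (size [seq H_neg H Sm i | i <- jumps Sm]).-tuple R =>
       nth 0%R v (index j (jumps Sm)))) => //.
  exact: measurable_nth_tuple.
apply: (@measurableT_comp _ _ _ _ _ _
  (fun u : (size [seq H_pos H Sp i | i <- jumps Sp]).-tuple R =>
     nth 0%R u (index j (jumps Sp)))) => //.
exact: measurable_nth_tuple.
Qed.

(** The cells read different coordinates of [V] and [U]. *)
Lemma sample_of_rectangle (A : 'I_N -> set R) :
  (forall i, measurable (A i)) ->
  (V_law H Sm \x U_law H Sp)
    [set vu | forall i, A i (tnth (sample_of_values vu) i)] =
  \prod_(c <- js)
    value_law c (\bigcap_(i in [set i | top (rk i) = c]) A i).
Proof.
move=> mA; pose B c := \bigcap_(i in [set i | top (rk i) = c]) A i.
have mB c : measurable (B c) by exact: fin_bigcap_measurable.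
have ju k (S : {ffun 'I_k.+1 -> 'I_k.+1}) : uniq (jumps S).
  by rewrite filter_uniq// enum_uniq.
pose EV := [set v : (size [seq H_neg H Sm i | i <- jumps Sm]).-tuple R |
  forall j, j \in jumps Sm -> B (inl j) (nth 0%R v (index j (jumps Sm)))].
pose EU := [set u : (size [seq H_pos H Sp i | i <- jumps Sp]).-tuple R |
  forall j, j \in jumps Sp -> B (inr j) (nth 0%R u (index j (jumps Sp)))].
have mrect k (I : eqType) (s : seq I) (C : I -> set R) :
    (forall i, measurable (C i)) -> measurable [set u : k.-tuple R |
      forall j, j \in s -> C j (nth 0%R u (index j s))].
  move=> mC; rewrite [X in measurable X](_ : _ = \bigcap_(j in [set` s])
      ((fun u : k.-tuple R => nth 0%R u (index j s)) @^-1` C j)).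
    apply: fin_bigcap_measurable; first exact: finite_seq.
    move=> j _; rewrite -[X in measurable X]setTI.
    exact: measurable_nth_tuple.
  by apply/seteqP; split.
have -> : [set vu | forall i, A i (tnth (sample_of_values vu) i)] = EV `*` EU.
  apply/seteqP; split => [[v u] /= vuA|[v u] [/= vB uB] i].
    split => j jS i /= ij; have := vuA i;
      by rewrite (tnth_sample_of tuniq rkE) ij.
  rewrite (tnth_sample_of tuniq rkE).
  have : top (rk i) \in js.
    by rewrite (mem_all_jumps rk_bij hSm hSp hpm hpp); exact: (codom_f (top \o rk)).
  case E : (top (rk i)) => [j|j]; rewrite mem_cat.
    rewrite (mem_map inl_inj) => /orP[/mapP[] //|jS].
    by apply: (vB j jS); rewrite /= E.
  rewrite (mem_map inr_inj) => /orP[jS|/mapP[] //].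
  by apply: (uB j jS); rewrite /= E.
rewrite product_measure1E; [|exact: (mrect _ _ _ (fun j => B (inl j)))|
  exact: (mrect _ _ _ (fun j => B (inr j)))].
have VE : V_law H Sm EV = \prod_(j <- jumps Sm) H_neg H Sm j (B (inl j)).
  exact: (tuple_prod_rectangle (H_neg H Sm) (ju _ Sm) (fun j => mB (inl j))).
have UE : U_law H Sp EU = \prod_(j <- jumps Sp) H_pos H Sp j (B (inr j)).
  exact: (tuple_prod_rectangle (H_pos H Sp) (ju _ Sp) (fun j => mB (inr j))).
apply: (eq_trans (y := _ * _)); first exact: (congr2 _ VE UE).
by rewrite big_cat !big_map muleC.
Qed.

(** The mass that the complete likelihood gives to one pair of tie partitions
    with these paths. *)
Definition path_weight : \bar R :=
  (chi (jump_sizes Sp ++ jump_sizes Sm))%:E * \prod_(c <- js) cell_weight c.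

Lemma path_weight_ge0 : 0 <= path_weight.
Proof.
rewrite mule_ge0//.
  by rewrite lee_fin -eppf_cell_top (eppf_ge0 Gchi)// preim_partitionP.
by apply: prode_ge0 => c _; apply: integral_ge0 => x _; exact: inv_power_ge0.
Qed.

Lemma path_weight_fin_num : path_weight \is a fin_num.
Proof.
rewrite fin_numM//; apply: (big_ind (fun x => x \is a fin_num)) => //.
  by move=> x y; exact: fin_numM.
move=> c _; rewrite ge0_fin_numE ?integral_inv_power_lty//.
by apply: integral_ge0 => x _; exact: inv_power_ge0.
Qed.

(** Two finite measures on samples are compared on rectangles: the law of the
    sample with prescribed ties weighted by the likelihood, and the law of the
    sample rebuilt from [V] and [U]. *)
Lemma ge0_integral_path_term (F : N.-tuple R -> \bar R) :
  (forall x, 0 <= F x) -> measurable_fun [set: N.-tuple R] F ->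
  \int[P]_w ((ker_partition (tnth (sample_tuple X w)) ==
              ker_partition (top \o rk))%:R%:E *
     (complete_likelihood theta t (sample_tuple X w) * F (sample_tuple X w))) =
  path_weight * \int[V_law H Sm \x U_law H Sp]_vu F (sample_of_values vu).
Proof.
move=> F0 mF.
pose rho w : \bar R := (ker_partition (tnth (sample_tuple X w)) ==
  ker_partition (top \o rk))%:R%:E *
  complete_likelihood theta t (sample_tuple X w).
have rho0 w : 0 <= rho w.
  by apply: mule_ge0; [rewrite lee_fin|exact: complete_likelihood_ge0].
have mrho : measurable_fun [set: Omega] rho.
  apply: (@measurableT_comp _ _ _ _ _ _ (fun x : N.-tuple R =>
    (ker_partition (tnth x) == ker_partition (top \o rk))%:R%:E *
    complete_likelihood theta t x)); last exact: measurable_sample_tuple.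
  apply: emeasurable_funM; last exact: measurable_complete_likelihood.
  exact: measurable_ker_indicator.
have mdir d' (Y : measurableType d') (S : Y -> N.-tuple R) (A : set (N.-tuple R)) :
    measurable_fun [set: Y] S -> measurable A ->
    measurable_fun [set: Y] (fun y => \d_(S y) A : \bar R).
  move=> mS mA; apply/measurable_EFinP.
  exact: (measurableT_comp (measurable_indic mA)).
have mdX A mA := @mdir _ _ _ A (measurable_sample_tuple X) mA.
have mdS A mA := @mdir _ _ _ A measurable_sample_of_values mA.
have k0 (vu : VU) : 0 <= path_weight by exact: path_weight_ge0.
have mk0 : measurable_fun [set: VU] (fun=> path_weight) by [].
transitivity (\int[mixture P rho0 mrho mdX]_x F x).
  rewrite ge0_integral_mixture//; apply: eq_integral => w _.
  by rewrite integral_dirac// diracT mul1e muleA.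
have m2E (h : N.-tuple R -> \bar R) : (forall x, 0 <= h x) ->
    measurable_fun [set: N.-tuple R] h ->
    \int[V_law H Sm \x U_law H Sp]_vu (path_weight * h (sample_of_values vu)) =
    path_weight * \int[V_law H Sm \x U_law H Sp]_vu h (sample_of_values vu).
  move=> h0 mh; apply: ge0_integralZl => //.
    by apply: (measurableT_comp mh); exact: measurable_sample_of_values.
  exact: path_weight_ge0.
rewrite -m2E//.
transitivity (\int[mixture (V_law H Sm \x U_law H Sp) k0 mk0 mdS]_x F x); last first.
  rewrite ge0_integral_mixture//; apply: eq_integral => vu _.
  by rewrite integral_dirac// diracT mul1e.
have rect1 (A : 'I_N -> set R) : (forall i, measurable (A i)) ->
    mixture P rho0 mrho mdX [set x | forall i, A i (tnth x i)] =
    path_weight * \prod_(c <- js)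
      value_law c (\bigcap_(i in [set i | top (rk i) = c]) A i).
  move=> mA; rewrite /path_weight -muleA -big_split/= -integral_path_rectangle//.
  apply: eq_integral => w _; rewrite -muleA; congr (_ * _); rewrite muleC.
  congr (_ * _); rewrite (prod_indic R A (tnth (sample_tuple X w))).
  by rewrite /= /dirac indicE.
have total : mixture P rho0 mrho mdX setT = path_weight.
  rewrite (_ : setT = [set x | forall i, [set: R] (tnth x i)]); last first.
    by apply/seteqP; split.
  rewrite (rect1 (fun=> setT))// big1 ?mule1// => c _.
  rewrite (_ : \bigcap_(i in _) _ = setT) ?probability_setT//.
  by apply/seteqP; split.
apply: eq_measure_integral => C mC _; apply: tuple_measure_unique mC.
  rewrite -[X in X < _]/(mixture P rho0 mrho mdX setT) total.
  by rewrite ltey_eq path_weight_fin_num.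
move=> A mA; rewrite [LHS]rect1// -sample_of_rectangle//.
have mR : measurable [set x : N.-tuple R | forall i, A i (tnth x i)].
  exact: measurable_rectangle.
have mS : measurable [set vu | forall i, A i (tnth (sample_of_values vu) i)].
  have := measurable_sample_of_values measurableT mR.
  by rewrite setTI.
rewrite -(setIT [set vu | _]) -integral_indic//.
rewrite -(m2E (fun x => (\1_[set x | forall i, A i (tnth x i)] x)%:E))//.
by apply/measurable_EFinP; exact: measurable_indic.
Qed.

Lemma eppf_jump_sizes : chi (cell_sizes pp) = chi (jump_sizes Sp).
Proof.
have [partp _ _] := path_partitionsP hSp hpp.
have [_ _ chiperm _] := Gchi.
apply: chiperm; last exact: cell_sizes_path.
have /and3P[_ _ p0] := partp.
apply/allP => _ /mapP[C + ->]; rewrite mem_enum => Cp.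
by rewrite card_gt0; apply: contraNneq p0 => <-.
Qed.

(** A sample has the prescribed ties only if its positive part has them.  This
    gives a meaning to the quotient of two values of [chi] in [phi_neg] when the
    denominator is [0]. *)
Lemma eppf_positive_part0 : chi (jump_sizes Sp) = 0%R ->
  chi (jump_sizes Sp ++ jump_sizes Sm) = 0%R.
Proof.
have [partp _ _] := path_partitionsP hSp hpp.
have [rki rkK rkiK] := rk_bij.
have finj : injective (fun j : 'I_n => rki (inr j)).
  by move=> i j /(can_inj rkiK) [].
have sampledY := sampled_from_sub H0 Gchi model finj.
have partr := preim_partitionP (top \o rk) [set: 'I_N]%SET.
rewrite -eppf_cell_top -eppf_jump_sizes => chi0; apply: EFin_inj.
rewrite (eppfE H0 Gchi sampledX partr).
have ties0 := etrans (esym (eppfE H0 Gchi sampledY partp)) (congr1 EFin chi0).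
apply: (subset_measure0 _ _ _ ties0).
- rewrite -[X in measurable X]setTI; apply: measurable_sample_tuple => //.
  exact: measurable_ker_partition.
- rewrite -[X in measurable X]setTI; apply: measurable_sample_tuple => //.
  exact: measurable_ker_partition.
move=> w /= /eq_ker_partition xtop; apply/(ker_partitionP _ partp) => i j.
rewrite !tnth_mktuple; have := xtop (rki (inr i)) (rki (inr j)).
by rewrite !tnth_mktuple /= !rkiK /= (inj_eq inr_inj) eq_top_of_cell.
Qed.

Lemma cell_weight_pos (j : 'I_n) : cell_weight (inr j) =
  (\int[H]_(u in `[(Ys theta t)`_j, +oo[) (u ^- incr Sp j))%R%:E.
Proof.
have eqw : \int[H]_(u in `[(Ys theta t)`_j%R, +oo[) (u ^- incr Sp j)%:E =
    cell_weight (inr j).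
  rewrite integral_indicM; apply: eq_integral => u _.
  rewrite /inv_power indicE mem_setE; case: (boolP (_ \in _)) => [|_]; last first.
    by rewrite mul0r mul0e.
  rewrite in_itv/= andbT => Yu; rewrite mul1r mul1e ger0_norm//.
  by rewrite (le_trans _ Yu)// ltW// Ys_gt0.
rewrite /Rintegral eqw fineK// ge0_fin_numE ?integral_inv_power_lty//.
by apply: integral_ge0 => x _; exact: inv_power_ge0.
Qed.

Lemma cell_weight_neg (j : 'I_m) : cell_weight (inl j) =
  (\int[H]_(v in `]-oo, (Zs theta t)`_j]) ((- v) ^- incr Sm j))%R%:E.
Proof.
have eqw : \int[H]_(v in `]-oo, (Zs theta t)`_j%R]) ((- v) ^- incr Sm j)%:E =
    cell_weight (inl j).
  rewrite integral_indicM; apply: eq_integral => u _.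
  rewrite /inv_power indicE mem_setE; case: (boolP (_ \in _)) => [|_]; last first.
    by rewrite mul0r mul0e.
  rewrite in_itv/= => uZ; rewrite mul1r mul1e ler0_norm//.
  by rewrite (le_trans uZ)// ltW// Zs_lt0.
rewrite /Rintegral eqw fineK// ge0_fin_numE ?integral_inv_power_lty//.
by apply: integral_ge0 => x _; exact: inv_power_ge0.
Qed.

(** The number of pairs of partitions with these paths, times the weight of each
    of them. *)
Lemma phi_path_weight :
  (phi_pos H chi Sp * phi_neg H chi Sm Sp)%:E =
  (#|path_partitions Sp| * #|path_partitions Sm|)%:R%:E * path_weight.
Proof.
have -> : path_weight = ((chi (jump_sizes Sp ++ jump_sizes Sm)) *
    ((\prod_(j <- jumps Sp)
       \int[H]_(u in `[((Ys theta t)`_j)%R, +oo[) (u ^- incr Sp j)) *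
     (\prod_(j <- jumps Sm)
       \int[H]_(v in `]-oo, ((Zs theta t)`_j)%R]) ((- v) ^- incr Sm j))))%R%:E.
  rewrite /path_weight EFinM; congr (_ * _).
  rewrite big_cat !big_map EFinM -!prodEFin; congr (_ * _);
    apply: eq_bigr => j _; [exact: cell_weight_pos|exact: cell_weight_neg].
rewrite -EFinM; congr EFin; rewrite /phi_pos /phi_neg natrM.
have [chi0|chi0] := eqVneq (chi (jump_sizes Sp)) 0%R.
  by rewrite chi0 (eppf_positive_part0 chi0) !(mulr0, mul0r).
by field.
Qed.

End fixed_paths.


(** The complete likelihood on the event that the ties are those of [pm] and
    [pp]. *)
Definition tie_likelihood (pm : {set {set 'I_m}}) (pp : {set {set 'I_n}})
    (x : N.-tuple R) : \bar R :=
  (ker_partition (tnth x) == ker_partition (cell_top pm pp \o rk))%:R%:E *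
  complete_likelihood theta t x.

Lemma tie_likelihood_ge0 pm pp x : 0 <= tie_likelihood pm pp x.
Proof.
by apply: mule_ge0; [rewrite lee_fin|exact: complete_likelihood_ge0].
Qed.

Lemma measurable_tie_likelihood pm pp :
  measurable_fun [set: N.-tuple R] (tie_likelihood pm pp).
Proof.
apply: emeasurable_funM; last exact: measurable_complete_likelihood.
exact: measurable_ker_indicator.
Qed.

(** Cells with the same largest member have the same size in both pairs, so a
    permutation of the observations turns one pair into the other.  It changes
    the likelihood of a given sample, but not on the event that the ties are the
    prescribed ones, where only the largest members matter. *)
Lemma tie_likelihood_exchange (Sm : neg_path theta t) (Sp : pos_path theta t)
    pm pp pm' pp' (B : set (pprobability R R)) :
  is_spath Sm -> is_spath Sp ->
  pm \in path_partitions Sm -> pp \in path_partitions Sp ->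
  pm' \in path_partitions Sm -> pp' \in path_partitions Sp ->
  measurable B ->
  \int[P]_(w in G @^-1` B) tie_likelihood pm pp (sample_tuple X w) =
  \int[P]_(w in G @^-1` B) tie_likelihood pm' pp' (sample_tuple X w).
Proof.
move=> hSm hSp hpm hpp hpm' hpp' mB.
have [partm _ _] := path_partitionsP hSm hpm.
have [partp _ _] := path_partitionsP hSp hpp.
have [partm' _ _] := path_partitionsP hSm hpm'.
have [partp' _ _] := path_partitionsP hSp hpp'.
have [s sE] : exists s : {perm 'I_N}, forall i,
    (cell_top pm pp \o rk) i = (cell_top pm' pp' \o rk) (s i).
  apply: same_fibers_perm => c.
  by rewrite (card_cell_top rk_bij hSm hSp hpm hpp)
    (card_cell_top rk_bij hSm hSp hpm' hpp').
rewrite -(exchangeable H0 Gchi model s mB (tie_likelihood_ge0 pm pp)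
  (measurable_tie_likelihood pm pp)).
apply: eq_integral => w _; rewrite /tie_likelihood.
set y := sample_tuple _ w; set x := sample_tuple X w.
have yx i : tnth y i = tnth x (s i) by rewrite !tnth_mktuple.
have kerE : ker_partition (tnth y) = ker_partition (cell_top pm pp \o rk) <->
    ker_partition (tnth x) = ker_partition (cell_top pm' pp' \o rk).
  split => /eq_ker_partition h; apply/eq_ker_partition => i j.
    have := h ((s^-1)%g i) ((s^-1)%g j).
    by rewrite !yx !sE !permKV.
  by rewrite !yx !sE h.
have [ky|ky] := pselect
    (ker_partition (tnth y) = ker_partition (cell_top pm pp \o rk)); last first.
  rewrite (introF eqP ky) (introF eqP (fun kx => ky (kerE.2 kx))).
  by rewrite !mul0e.
have kx := kerE.1 ky; rewrite ky kx !eqxx; congr (_ * _).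
rewrite !(complete_likelihoodE rkE).
rewrite (prod_inv_power_cell_top rk_bij partm partp ky).
rewrite (prod_inv_power_cell_top rk_bij partm' partp' kx).
rewrite [RHS](reindex_inj (@perm_inj _ s))/=; apply: eq_bigr => i _.
by rewrite yx -[cell_top pm pp (rk i)]/((cell_top pm pp \o rk) i) sE.
Qed.

Lemma integral_complete_likelihood_lty :
  \int[P]_w complete_likelihood theta t (sample_tuple X w) < +oo.
Proof.
pose b := (\prod_(i < N) `|datum (rk i)|^-1)%R.
apply: (@le_lt_trans _ _ (\int[P]_w cst b%:E w)).
  apply: ge0_le_integral => //.
  - by move=> w _; exact: complete_likelihood_ge0.
  - apply: measurableT_comp; first exact: measurable_complete_likelihood.
    exact: measurable_sample_tuple.
  move=> w _; rewrite /complete_likelihood lee_fin; apply: ler_prod => i _.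
  rewrite kern_ge0/= -lee_fin (kern_admissible _ (rkE i)).
  by have := inv_power_admissible_le (rk i) 1; rewrite expr1; apply.
rewrite integral_cst// [X in _ * X](_ : _ = 1) ?mule1 ?ltry//.
exact: probability_setT.
Qed.

Variable Q : R.-pker (N.-tuple R) ~> (pprobability R R).
Hypothesis condQ : cond_law_given_sample G theta X t Q.

(** The kernel [Q] is characterized under the law weighted by the complete
    likelihood, which is the weight that the event carries. *)
Lemma tie_likelihood_cond_law pm pp (B : set (pprobability R R)) : measurable B ->
  \int[P]_(w in G @^-1` B) tie_likelihood pm pp (sample_tuple X w) =
  \int[P]_w (tie_likelihood pm pp (sample_tuple X w) * Q (sample_tuple X w) B).
Proof.
move=> mB; set l := cell_top pm pp \o rk.
have partl := preim_partitionP l [set: 'I_N]%SET.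
pose K := [set x : N.-tuple R | ker_partition (tnth x) = ker_partition l].
have mK : measurable K by exact: (measurable_ker_partition partl).
pose L w := complete_likelihood theta t (sample_tuple X w).
have L0 w : 0 <= L w by exact: complete_likelihood_ge0.
have mL : measurable_fun [set: Omega] L.
  apply: measurableT_comp; first exact: measurable_complete_likelihood.
  exact: measurable_sample_tuple.
have mGB : measurable (G @^-1` B).
  by rewrite -[X in measurable X]setTI; exact: (measurable_funPT G).
have mXK : measurable (sample_tuple X @^-1` K).
  by rewrite -[X in measurable X]setTI; exact: measurable_sample_tuple.
have mQ : measurable_fun [set: Omega] (fun w => Q (sample_tuple X w) B).
  apply: (measurableT_comp (measurable_kernel Q B mB)).
  exact: measurable_sample_tuple.
have kerE w : (ker_partition (tnth (sample_tuple X w)) ==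
    ker_partition l)%:R%:E = (\1_(sample_tuple X @^-1` K) w)%:E :> \bar R.
  rewrite indicE; congr ((nat_of_bool _)%:R%:E).
  by apply/eqP/idP => [?|/set_mem//]; exact/mem_set.
have := condQ mK mB; move=> /(congr1 (fun z => \int[P]_w L w * z)).
rewrite tiltE; [|exact: integral_complete_likelihood_lty|exact: measurableI].
rewrite [X in _ * X]integral_indicM ge0_integral_tilt; last 3 first.
- exact: integral_complete_likelihood_lty.
- by move=> w; rewrite mule_ge0 ?lee_fin.
- by apply: emeasurable_funM => //; apply/measurable_EFinP; exact: measurable_indic.
move=> condE; transitivity (\int[P]_(w in sample_tuple X @^-1` K `&` G @^-1` B) L w).
  rewrite [LHS]integral_indicM [RHS]integral_indicM; apply: eq_integral => w _.
  rewrite /tie_likelihood -/l kerE muleA -/(L w); congr (_ * _).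
  by rewrite -EFinM setIC indicI.
rewrite condE; apply: eq_integral => w _; rewrite /tie_likelihood -/l kerE -/(L w).
by rewrite muleA [L w * _]muleC.
Qed.

Variables (pm : neg_path theta t -> {set {set 'I_m}})
  (pp : pos_path theta t -> {set {set 'I_n}}).
Hypotheses (hpm : forall Sm, is_spath Sm -> pm Sm \in path_partitions Sm)
  (hpp : forall Sp, is_spath Sp -> pp Sp \in path_partitions Sp).

Let J Sm Sp (B : set (pprobability R R)) :=
  \int[V_law H Sm \x U_law H Sp]_vu
    Q (sample_of Sm Sp (pm Sm) (pp Sp) vu.1 vu.2) B.

(** The law of [G] jointly with the data, up to the law of the data. *)
Lemma joint_law_paths (B : set (pprobability R R)) : measurable B ->
  \int[P]_(w in G @^-1` B) complete_likelihood theta t (sample_tuple X w) =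
  \sum_(Sp : pos_path theta t | is_spath Sp)
    \sum_(Sm : neg_path theta t | is_spath Sm)
      (phi_pos H chi Sp * phi_neg H chi Sm Sp)%:E * J Sm Sp B.
Proof.
move=> mB.
have mGB : measurable (G @^-1` B).
  by rewrite -[X in measurable X]setTI; exact: (measurable_funPT G).
have mt q q' : measurable_fun (G @^-1` B)
    (fun w => tie_likelihood q q' (sample_tuple X w)).
  apply: measurable_funTS; apply: measurableT_comp.
    exact: measurable_tie_likelihood.
  exact: measurable_sample_tuple.
transitivity (\sum_(q : {set {set 'I_n}} | finset.partition q [set: 'I_n]%SET)
    \sum_(q' : {set {set 'I_m}} | finset.partition q' [set: 'I_m]%SET)
      \int[P]_(w in G @^-1` B) tie_likelihood q' q (sample_tuple X w)).
  under eq_integral do rewrite (complete_likelihood_split rk_bij rkE).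
  rewrite ge0_integral_sum_cond//; last 2 first.
  - move=> q; under eq_fun do rewrite -big_filter.
    by apply: emeasurable_sum => q'; exact: mt.
  - by move=> q w _; apply: sume_ge0 => q' _; exact: tie_likelihood_ge0.
  apply: eq_bigr => q _; apply: ge0_integral_sum_cond => //.
    by move=> q'; exact: mt.
  by move=> q' w _; exact: tie_likelihood_ge0.
rewrite sum_partition_path; apply: eq_bigr => Sp hSp.
transitivity (\sum_(q in path_partitions Sp)
    \sum_(Sm : neg_path theta t | is_spath Sm)
    \sum_(q' in path_partitions Sm)
      \int[P]_(w in G @^-1` B) tie_likelihood q' q (sample_tuple X w)).
  by apply: eq_bigr => q _; exact: sum_partition_path.
rewrite exchange_big/=; apply: eq_bigr => Sm hSm.
transitivity (\sum_(q in path_partitions Sp) \sum_(q' in path_partitions Sm)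
    (path_weight Sm Sp * J Sm Sp B)).
  apply: eq_bigr => q hq; apply: eq_bigr => q' hq'.
  rewrite (tie_likelihood_exchange hSm hSp hq' hq (hpm hSm) (hpp hSp) mB).
  rewrite tie_likelihood_cond_law//.
  rewrite -(ge0_integral_path_term hSm hSp (hpm hSm) (hpp hSp)
    (F := fun x => Q x B))//; last exact: measurable_kernel.
  by apply: eq_integral => w _; rewrite -muleA.
rewrite (phi_path_weight hSm hSp (hpm hSm) (hpp hSp)).
have w0 : 0 <= path_weight Sm Sp * J Sm Sp B.
  rewrite mule_ge0 ?integral_ge0//.
  exact: (path_weight_ge0 hSm hSp (hpm hSm) (hpp hSp)).
under eq_bigr do rewrite sume_const//.
rewrite sume_const; last by rewrite mule_ge0// lee_fin.
by rewrite natrM EFinM !muleA.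
Qed.

Lemma data_densityE : \int[P]_w complete_likelihood theta t (sample_tuple X w) =
  (\sum_(Sp : pos_path theta t | is_spath Sp)
    \sum_(Sm : neg_path theta t | is_spath Sm)
      phi_pos H chi Sp * phi_neg H chi Sm Sp)%R%:E.
Proof.
have := joint_law_paths measurableT; rewrite preimage_setT => ->.
rewrite -sumEFin; apply: eq_bigr => Sp _; rewrite -sumEFin.
apply: eq_bigr => Sm _; rewrite [X in _ * X](_ : _ = 1) ?mule1//.
transitivity (\int[V_law H Sm \x U_law H Sp]_vu cst 1 vu).
  by apply: eq_integral => vu _; exact: prob_kernel.
by rewrite integral_cst// mul1e; exact: probability_setT.
Qed.

Lemma marginal_densityE : marginal_density G theta t =
  \int[P]_w complete_likelihood theta t (sample_tuple X w).
Proof.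
rewrite /marginal_density ge0_integral_distribution//; last 2 first.
- exact: measurable_likelihood.
- exact: likelihood_ge0.
have := integral_kernels H0 Gchi model (f := fun i x => (kern theta x (tnth t i))%:E)
  measurableT; rewrite preimage_setT => <-.
- by apply: eq_integral => w _; rewrite /complete_likelihood -prodEFin;
    apply: eq_bigr => i _; rewrite tnth_mktuple.
- by move=> i x; rewrite lee_fin kern_ge0.
- by move=> i; apply/measurable_EFinP; exact: measurable_kern.
Qed.

Hypothesis density_pos : 0 < marginal_density G theta t.

Lemma path_prob_ge0 (Sm : neg_path theta t) (Sp : pos_path theta t) :
  is_spath Sm -> is_spath Sp ->
  (0 <= path_prob H chi Sm Sp)%R.
Proof.
have phi0 (Sm' : neg_path theta t) (Sp' : pos_path theta t) :
    is_spath Sm' -> is_spath Sp' ->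
    (0 <= phi_pos H chi Sp' * phi_neg H chi Sm' Sp')%R.
  move=> hSm hSp; rewrite -lee_fin (phi_path_weight hSm hSp (hpm hSm) (hpp hSp)).
  rewrite mule_ge0 ?lee_fin//.
  exact: (path_weight_ge0 hSm hSp (hpm hSm) (hpp hSp)).
move=> hSm hSp; rewrite /path_prob divr_ge0 ?phi0// sumr_ge0// => Sp' hSp'.
by rewrite sumr_ge0// => Sm' hSm'; exact: phi0.
Qed.

Lemma posterior_paths (B : set (pprobability R R)) : measurable B ->
  posterior G theta t B =
  \sum_(Sp : pos_path theta t | is_spath Sp)
    \sum_(Sm : neg_path theta t | is_spath Sm)
      (path_prob H chi Sm Sp)%:E * J Sm Sp B.
Proof.
move=> mB; pose Z := (\sum_(Sp : pos_path theta t | is_spath Sp)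
    \sum_(Sm : neg_path theta t | is_spath Sm)
      phi_pos H chi Sp * phi_neg H chi Sm Sp)%R.
have mdE : marginal_density G theta t = Z%:E.
  by rewrite marginal_densityE data_densityE.
have Zpos : (0 < Z)%R by rewrite -lte_fin -mdE.
have J0 Sm Sp : 0 <= J Sm Sp B by exact: integral_ge0.
have ZB : Z%:E * posterior G theta t B = \sum_(Sp : pos_path theta t | is_spath Sp)
    \sum_(Sm : neg_path theta t | is_spath Sm)
      (phi_pos H chi Sp * phi_neg H chi Sm Sp)%:E * J Sm Sp B.
  rewrite -joint_law_paths// -mdE [LHS]tiltE//; last first.
    by rewrite -/(marginal_density _ _ _) mdE ltry.
  rewrite ge0_integral_pushforward//; last 2 first.
  - by apply: measurable_funTS; exact: measurable_likelihood.
  - by move=> Gam _; exact: likelihood_ge0.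
  have := integral_kernels H0 Gchi model
    (f := fun i x => (kern theta x (tnth t i))%:E) mB => <-.
  - by apply: eq_integral => w _; rewrite /complete_likelihood -prodEFin;
      apply: eq_bigr => i _; rewrite tnth_mktuple.
  - by move=> i x; rewrite lee_fin kern_ge0.
  - by move=> i; apply/measurable_EFinP; exact: measurable_kern.
rewrite -[LHS]mul1e -(mulVf (lt0r_neq0 Zpos)) EFinM -muleA ZB.
rewrite ge0_sume_distrr; last first.
  move=> Sp hSp; apply: sume_ge0 => Sm hSm; rewrite mule_ge0//.
  rewrite (phi_path_weight hSm hSp (hpm hSm) (hpp hSp)) mule_ge0 ?lee_fin//.
  exact: (path_weight_ge0 hSm hSp (hpm hSm) (hpp hSp)).
apply: eq_bigr => Sp hSp; rewrite ge0_sume_distrr; last first.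
  move=> Sm hSm; rewrite mule_ge0//.
  rewrite (phi_path_weight hSm hSp (hpm hSm) (hpp hSp)) mule_ge0 ?lee_fin//.
  exact: (path_weight_ge0 hSm hSp (hpm hSm) (hpp hSp)).
apply: eq_bigr => Sm hSm; rewrite muleA -EFinM; congr (EFin _ * _).
by rewrite /path_prob -/Z mulrC.
Qed.

(** By [posterior_paths] the posterior is a finite sum of mixtures of [Q]. *)
Lemma ge0_integral_posterior (g : pprobability R R -> \bar R) :
  (forall Gam, 0 <= g Gam) -> measurable_fun [set: pprobability R R] g ->
  \int[posterior G theta t]_Gam g Gam =
  \sum_(Sp : pos_path theta t | is_spath Sp)
    \sum_(Sm : neg_path theta t | is_spath Sm)
      (\int[V_law H Sm \x U_law H Sp]_vu
         \int[Q (sample_of Sm Sp (pm Sm) (pp Sp) vu.1 vu.2)]_Gam g Gam) *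
      (path_prob H chi Sm Sp)%:E.
Proof.
move=> g0 mg.
pose k (S : pos_path theta t * neg_path theta t)
    (vu : (size [seq H_neg H S.2 i | i <- jumps S.2]).-tuple R *
          (size [seq H_pos H S.1 i | i <- jumps S.1]).-tuple R) :
    {measure set (pprobability R R) -> \bar R} :=
  Q (sample_of S.2 S.1 (pm S.2) (pp S.1) vu.1 vu.2).
have mk S B : measurable B -> measurable_fun setT (fun vu => k S vu B).
  move=> mB; apply: (measurableT_comp (measurable_kernel Q B mB)).
  exact: measurable_sample_of_values.
have w0 (S : pos_path theta t * neg_path theta t) :
    0 <= `|path_prob H chi S.2 S.1|%:E.
  by rewrite lee_fin.
have mw (S : pos_path theta t * neg_path theta t) :
    measurable_fun setT (fun _ :
          (size [seq H_neg H S.2 i | i <- jumps S.2]).-tuple R *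
          (size [seq H_pos H S.1 i | i <- jumps S.1]).-tuple R =>
      `|path_prob H chi S.2 S.1|%:E) by [].
pose s := [seq S : pos_path theta t * neg_path theta t <- index_enum _ |
  is_spath S.1 && is_spath S.2].
have [mu muE muI] := finite_sum_measure s (fun S =>
  mixture (V_law H S.2 \x U_law H S.1) (fun=> w0 S) (mw S) (mk S)).
have wE (S : pos_path theta t * neg_path theta t) :
    is_spath S.1 && is_spath S.2 ->
    `|path_prob H chi S.2 S.1|%:E = (path_prob H chi S.2 S.1)%:E.
  by move=> /andP[hSp hSm]; rewrite ger0_norm// path_prob_ge0.
have mkg S : measurable_fun setT (fun vu => \int[k S vu]_Gam g Gam).
  by apply: measurable_fun_integral_kernel => // B; exact: mk.
rewrite (eq_measure_integral mu); last first.
  move=> B mB _; apply: (eq_trans (posterior_paths mB)).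
  rewrite muE pair_big/= big_filter.
  apply: eq_bigr => S hS; rewrite -(wE S hS); apply/esym.
  by apply: ge0_integralZl => //; exact: (mk S B mB).
rewrite muI// pair_big/= big_filter; apply: eq_bigr => S hS.
rewrite ge0_integral_mixture// -(wE S hS) muleC.
apply: ge0_integralZl => //; first exact: mkg.
by move=> vu _; exact: integral_ge0.
Qed.

(** The formula for the positive and the negative part of [g] has finite values,
    which makes the inner integrals of both finite for each pair of paths of
    positive probability; only there is their difference meaningful. *)
Lemma integral_posterior (g : pprobability R R -> \bar R) :
  (posterior G theta t).-integrable [set: pprobability R R] g ->
  \int[posterior G theta t]_Gam g Gam =
  \sum_(Sp : pos_path theta t | is_spath Sp)
    \sum_(Sm : neg_path theta t | is_spath Sm)
      (\int[V_law H Sm \x U_law H Sp]_vu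
         \int[Q (sample_of Sm Sp (pm Sm) (pp Sp) vu.1 vu.2)]_Gam g Gam) *
      (path_prob H chi Sm Sp)%:E.
Proof.
move=> gi; have mg := measurable_int _ gi.
have gpfin := integrable_pos_fin_num measurableT gi.
have gnfin := integrable_neg_fin_num measurableT gi.
have mgp := measurable_funepos mg; have mgn := measurable_funeneg mg.
have gpE := ge0_integral_posterior (funepos_ge0 g) mgp.
have gnE := ge0_integral_posterior (funeneg_ge0 g) mgn.
rewrite gpE pair_big/= in gpfin; rewrite gnE pair_big/= in gnfin.
rewrite integralE gpE gnE !pair_big/=.
have prob0 (S : pos_path theta t * neg_path theta t) :
    is_spath S.1 && is_spath S.2 -> (0 <= path_prob H chi S.2 S.1)%R.
  by move=> /andP[hSp hSm]; exact: path_prob_ge0.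
apply: (sum_weighted_diff prob0 _ _ gpfin gnfin).
- by move=> S _; do 2 (apply: integral_ge0 => ? _).
- by move=> S _; do 2 (apply: integral_ge0 => ? _).
move=> [Sp Sm] /andP[/= hSp hSm] afin bfin.
apply: integral_kernel_funeposneg => // B mB.
apply: (measurableT_comp (measurable_kernel Q B mB)).
exact: measurable_sample_of_values.
Qed.

End path_term.

Theorem theorem2p2 (R : realType) (d : measure_display)
    (Omega : measurableType d) (P : probability Omega R)
    (H : probability R R) (K : set nat) (W xi : nat -> {RV P >-> R})
    (G : {RV P >-> pprobability R R}) (chi : seq nat -> R)
    (theta : R) (N : nat) (X T : 'I_N -> {RV P >-> R}) (t : N.-tuple R)
    (Q : R.-pker (N.-tuple R) ~> (pprobability R R))
    (pm : neg_path theta t -> {set {set 'I_(size (Zs theta t))}})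
    (pp : pos_path theta t -> {set {set 'I_(size (Ys theta t))}})
    (g : pprobability R R -> \bar R) :
  species_sampling_model K W xi H G ->
  is_eppf H G chi ->
  mixture_model G theta X T ->
  uniq t -> theta \notin t ->
  0 < marginal_density G theta t ->
  cond_law_given_sample G theta X t Q ->
  (forall Sm, is_spath Sm -> pm Sm \in path_partitions Sm) ->
  (forall Sp, is_spath Sp -> pp Sp \in path_partitions Sp) ->
  measurable_fun [set: pprobability R R] g ->
  (forall Gam, 0 <= g Gam) \/
    (posterior G theta t).-integrable [set: pprobability R R] g ->
  \int[posterior G theta t]_Gam g Gam =
  \sum_(Sp : pos_path theta t | is_spath Sp)
    \sum_(Sm : neg_path theta t | is_spath Sm)
      (\int[V_law H Sm \x U_law H Sp]_vu
         \int[Q (sample_of Sm Sp (pm Sm) (pp Sp) vu.1 vu.2)]_Gam g Gam) *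
      (path_prob H chi Sm Sp)%:E.
Proof.
move=> [H0 _ _ _] Gchi model tuniq thetat density_pos condQ hpm hpp mg.
have [rk rk_bij rkE] := rank_of_data tuniq thetat.
case=> [g0|gi].
  exact: (ge0_integral_posterior H0 Gchi model tuniq rk_bij rkE condQ).
exact: (integral_posterior H0 Gchi model tuniq rk_bij rkE condQ).
Qed.
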